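(* Fix $d\in\mathbb N$ and a $k$-ary boolean CSP MAX-$\Pi$ with $d\ge2\lceil k/2\rceil$, and let $0\le s\le c\le 1$. Suppose the degree-$d$ sos relaxation does not achieve a $(c,s)$-approximation for MAX-$\Pi$. Then no sequence of SDP relaxations $\{\mathcal S_n\}$ for MAX-$\Pi_n$ of sizes $r_n=o\left((n/\log n)^{d/4}\right)$ achieves a $(c,s)$-approximation for MAX-$\Pi$.
   Context: A $k$-ary boolean CSP MAX-$\Pi$ is given by a finite collection of predicates $\{0,1\}^k\to\{0,1\}$; an instance $\Im\in$ MAX-$\Pi_n$ on $n$ variables is a list of constraints $P_i(X)=P(X_{i_1},\dots,X_{i_k})$ with $P$ in the collection and distinct indices, identified with $\Im(x)=\frac1M\sum_{i=1}^MP_i(x)$; $\mathrm{opt}(\Im)=\max_{x\in\{0,1\}^n}\Im(x)$. An SDP relaxation of size $r$ for MAX-$\Pi_n$ consists of vectors $\tilde\Im\in\mathbb{R}^{r\times r}$ for each instance and $\tilde x\in\mathbb{R}^{r\times r}$ for each $x\in\{0,1\}^n$ with $\Im(x)=\langle\tilde\Im,\tilde x\rangle$ (Frobenius inner product), together with a set $\mathcal S=\{y\in\mathbb{R}^{r\times r}: Ay=b,\ y \text{ symmetric psd}\}$ (for some linear map $A$ and vector $b$) containing every $\tilde x$; its value on $\Im$ is $\mathcal S(\Im)=\max_{y\in\mathcal S}\langle\tilde\Im,y\rangle$. A sequence $\{\mathcal S_n\}$ achieves a $(c,s)$-approximation if for every $n$ and every $\Im\in$ MAX-$\Pi_n$ with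 $\mathrm{opt}(\Im)\le s$, $\mathcal S_n(\Im)\le c$. The degree-$d$ sos relaxation value is $\overline{\mathrm{sos}}_d(\Im)=\min\{c': c'-\Im=\sum_i g_i^2 \text{ on }\{0,1\}^n,\ \deg(g_i)\le d/2\}$ (degree = multilinear degree); it achieves a $(c,s)$-approximation if $\overline{\mathrm{sos}}_d(\Im)\le c$ for every $n$ and every instance with $\mathrm{opt}(\Im)\le s$. *)

(* Defs.v *)
From HB Require Import structures.
From mathcomp Require Import all_boot all_order all_algebra.
From mathcomp Require Import all_classical all_reals all_analysis.

Set Implicit Arguments.
Unset Strict Implicit.
Unset Printing Implicit Defensive.

Import Order.TTheory GRing.Theory Num.Theory.
Import numFieldNormedType.Exports.

Local Open Scope classical_set_scope.
Local Open Scope ring_scope.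

Definition cube (n : nat) := {ffun 'I_n -> bool}.

Definition predicate (k : nat) := {ffun cube k -> bool}.

(** The pair [(P, i)] stands for the constraint P(X_{i_1}, ..., X_{i_k}). *)
Definition constraint (k n : nat) := (predicate k * {ffun 'I_k -> 'I_n})%type.

Definition satisfied (k n : nat) (C : constraint k n) (x : cube n) : bool :=
  C.1 [ffun j => x (C.2 j)].

(** Instances of MAX-Pi on n variables; a constraint may be repeated, and the
    list is nonempty because of the normalization by its length. *)
Record instance (k : nat) (Pi : {set predicate k}) (n : nat) := Instance {
  constraints : seq (constraint k n);
  constraints_neq0 : constraints != [::];
  constraints_in :
    all (fun C : constraint k n => (C.1 \in Pi) && injectiveb C.2) constraints }.

Section Relaxations.
Variables (R : realType) (k : nat) (Pi : {set predicate k}).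

Definition value (n : nat) (I : instance Pi n) (x : cube n) : R :=
  (size (constraints I))%:R^-1 *
  \sum_(C <- constraints I) (satisfied C x)%:R.

(** The default 0 of the maximum is harmless, since values are nonnegative and
    the cube is nonempty. *)
Definition opt (n : nat) (I : instance Pi n) : R :=
  \big[Num.max/0]_(x : cube n) value I x.

Definition frobenius (r : nat) (A B : 'M[R]_r) : R := \tr (A^T *m B).

Definition psd (r : nat) (y : 'M[R]_r) : Prop :=
  y^T = y /\ forall v : 'cV[R]_r, 0 <= (v^T *m y *m v) 0 0.

Record sdp_relaxation (n r : nat) := SDPRelaxation {
  sdp_instance : instance Pi n -> 'M[R]_r;
  sdp_point : cube n -> 'M[R]_r;
  sdp_codim : nat;
  sdp_map : {linear 'M[R]_r -> 'cV[R]_sdp_codim};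
  sdp_rhs : 'cV[R]_sdp_codim;
  sdp_valueE : forall I x,
    value I x = frobenius (sdp_instance I) (sdp_point x);
  sdp_point_feasible : forall x,
    sdp_map (sdp_point x) = sdp_rhs /\ psd (sdp_point x) }.

Definition sdp_feasible (n r : nat) (S : sdp_relaxation n r) : set 'M[R]_r :=
  [set y | sdp_map S y = sdp_rhs S /\ psd y].

(** A supremum in the extended reals: a linear functional need not be bounded,
    nor attain its bound, on [sdp_feasible S]. *)
Definition sdp_value (n r : nat) (S : sdp_relaxation n r) (I : instance Pi n) :
    \bar R :=
  ereal_sup [set (frobenius (sdp_instance S I) y)%:E | y in sdp_feasible S].

Definition sdp_achieves (r : nat -> nat)
    (S : forall n : nat, sdp_relaxation n (r n)) (c s : R) : Prop :=
  forall (n : nat) (I : instance Pi n),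
    opt I <= s -> (sdp_value (S n) I <= c%:E)%E.

(** Real functions on the cube are given by their multilinear polynomials,
    encoded by coefficients: [p T] is that of the product of the x_i, i in T. *)
Definition mlpoly (n : nat) := {ffun {set 'I_n} -> R}.

Definition mleval (n : nat) (p : mlpoly n) (x : cube n) : R :=
  \sum_(T : {set 'I_n}) p T * \prod_(i in T) (x i)%:R.

Definition mldeg (n : nat) (p : mlpoly n) : nat :=
  \max_(T : {set 'I_n} | p T != 0) #|T|.

(** deg(g) <= d/2 is written 2 * deg(g) <= d, so d may be odd. *)
Definition is_sos (d n : nat) (f : cube n -> R) : Prop :=
  exists gs : seq (mlpoly n),
    (forall g, g \in gs -> (2 * mldeg g <= d)%N) /\
    (forall x, f x = \sum_(g <- gs) mleval g x ^+ 2).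

Definition sos_value (d n : nat) (I : instance Pi n) : \bar R :=
  ereal_inf [set c'%:E | c' in [set c' : R |
    is_sos d (fun x => c' - value I x)]].

Definition sos_achieves (d : nat) (c s : R) : Prop :=
  forall (n : nat) (I : instance Pi n),
    opt I <= s -> (sos_value d I <= c%:E)%E.

End Relaxations.

Arguments sos_achieves {R k} Pi d c s.
Arguments sdp_relaxation R {k} Pi n r.

(* Main.v *)
(** A bad instance [I] on [m] variables and a separating hyperplane of the cone of sums
    of squares give a function [D] on the cube with [sum D (c - I) < 0], but
    [sum D g^2 >= 0] for [deg g <= d / 2]. Plant [I] on the sections [s] of [m] blocks of
    [b] variables. By duality a good SDP relaxation of size [r] writes [c - I_s(x)] as
    [tr (L_s R(x))], up to a nonnegative constant and a small error, with [L_s] and [R(x)]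
    psd; hence [sum_x tr (Z R) < 0], where [Z(x)] is the average of [D(x|s) L_s] over [s].
    A determinant-maximizing choice of basis makes the average of the [L_s] at most 1,
    each [L_s] at most [2 r^2], and [tr R(x)] at most 5.

    Then [Y = B - Z] is psd of degree [m], and the moments [sum_x tr (R Y^q)], hence also
    the moments [sum_x tr Y^q], grow at a rate larger than [B]. Since the latter start at
    [2^n r] and are log-convex, [sum_x tr (Z Y^(2N)) < - eps sum_x tr Y^(2N)] for some [N]
    of order [log r]. But [Y^N] has degree [N m], and the part of it that has
    degree more than [d / 2] on a random section carries only a fraction
    [O ((N / b)^(floor (d / 2) + 1))] of its mass; so positivity of [D] on squares gives the
    opposite inequality as soon as [r^2 (N / b)^(floor (d / 2) + 1)] is small. *)
Require Import Defs.
From mathcomp Require Import all_boot all_order all_algebra.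
From mathcomp Require Import all_classical all_reals all_analysis.
From mathcomp Require Import ring lra.

Set Implicit Arguments.
Unset Strict Implicit.
Unset Printing Implicit Defensive.

Import Order.TTheory GRing.Theory Num.Theory.
Import numFieldNormedType.Exports.

Local Open Scope ring_scope.

(** * Positive semidefinite matrices *)

Section PositiveSemidefinite.
Variable R : realType.

(** The degenerate case [c = 0] is included, so that Cauchy-Schwarz follows for forms that are only
    semidefinite. *)
Lemma discriminant_le (a b c : R) : 0 <= c ->
  (forall t, 0 <= a + (t * b) *+ 2 + t ^+ 2 * c) -> b ^+ 2 <= a * c.
Proof.
rewrite le_eqVlt => /orP[/eqP<- h|c0 h].
  have [->|b0] := eqVneq b 0; first by rewrite expr0n mulr0.
  (* For [c = 0] the expression is affine in [t], and this [t] gives it the value -1. *)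
  have := h (- (a + 1) / (b *+ 2)); rewrite mulr0 addr0.
  suff -> : a + (- (a + 1) / (b *+ 2) * b) *+ 2 = -1 by rewrite ler0N1.
  by field.
have := h (- b / c).
have -> : a + (- b / c * b) *+ 2 + (- b / c) ^+ 2 * c = (a * c - b ^+ 2) / c.
  by field; rewrite gt_eqF.
by rewrite pmulr_lge0 ?invr_gt0// subr_ge0.
Qed.

Lemma mx11_tr (a : 'M[R]_1) : a^T = a.
Proof. by apply/matrixP => i j; rewrite !ord1 mxE. Qed.

Section Fixed_size.
Variable r : nat.
Implicit Types (A B : 'M[R]_r) (u v w : 'cV[R]_r).

Lemma psd_CauchySchwarz A u v : psd A ->
  (u^T *m A *m v) 0 0 ^+ 2 <= (u^T *m A *m u) 0 0 * (v^T *m A *m v) 0 0.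
Proof.
move=> [sA pA]; apply: discriminant_le => // t.
have := pA (u + t *: v).
have e : (v^T *m A *m u) = (u^T *m A *m v).
  by rewrite -[LHS]mx11_tr !trmx_mul trmxK sA mulmxA.
have -> : (u + t *: v)^T = u^T + t *: v^T by rewrite linearD/= linearZ.
rewrite !mulmxDl !mulmxDr -?scalemxAl -?scalemxAr -?scalemxAl e.
move: (u^T *m A *m u) (u^T *m A *m v) (v^T *m A *m v) => a b c.
rewrite !mxE => h; apply: le_trans h _; rewrite le_eqVlt; apply/orP; left.
by apply/eqP; ring.
Qed.

Lemma psdD A B : psd A -> psd B -> psd (A + B).
Proof.
move=> [sA pA] [sB pB]; split; first by rewrite linearD/= sA sB.
by move=> v; rewrite mulmxDr mulmxDl mxE addr_ge0.
Qed.

Lemma psdZ (a : R) A : 0 <= a -> psd A -> psd (a *: A).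
Proof.
move=> a0 [sA pA]; split; first by rewrite linearZ/= sA.
by move=> v; rewrite -scalemxAr -scalemxAl mxE mulr_ge0.
Qed.

Lemma psd0 : psd (0 : 'M[R]_r).
Proof. by split=> [|v]; rewrite ?trmx0// mulmx0 mul0mx mxE. Qed.

Lemma psd_sum (I : Type) (s : seq I) (P : pred I) (F : I -> 'M[R]_r) :
  (forall i, P i -> psd (F i)) -> psd (\sum_(i <- s | P i) F i).
Proof. by move=> h; apply: big_ind => //; [exact: psd0|exact: psdD]. Qed.

Lemma psd_mul_tr s (G : 'M[R]_(r, s)) : psd (G *m G^T).
Proof.
split=> [|v]; first by rewrite trmx_mul trmxK.
rewrite mulmxA -mulmxA -[G^T *m v]trmxK trmx_mul trmxK mxE sumr_ge0// => i _.
by rewrite [X in _ * X]mxE -expr2 sqr_ge0.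
Qed.

Lemma psd_conj s (M : 'M[R]_(s, r)) A : psd A -> psd (M *m A *m M^T).
Proof.
move=> [sA pA]; split; first by rewrite !trmx_mul trmxK sA mulmxA.
by move=> v; have := pA (M^T *m v); rewrite trmx_mul trmxK !mulmxA.
Qed.

Lemma psd1 : psd (1%:M : 'M[R]_r).
Proof. by have := psd_mul_tr (1%:M : 'M[R]_r); rewrite trmx1 mulmx1. Qed.

Lemma delta_form A (i j : 'I_r) :
  ((delta_mx i 0 : 'cV_r)^T *m A *m (delta_mx j 0 : 'cV_r)) 0 0 = A i j.
Proof. by rewrite trmx_delta -rowE -colE !mxE. Qed.

Lemma psd_diag_ge0 A i : psd A -> 0 <= A i i.
Proof. by move=> [_ pA]; have := pA (delta_mx i 0); rewrite delta_form. Qed.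

Lemma psd_entry_sqr A i j : psd A -> A i j ^+ 2 <= A i i * A j j.
Proof.
move=> pA; have := psd_CauchySchwarz (delta_mx i 0) (delta_mx j 0) pA.
by rewrite !delta_form.
Qed.

Lemma outer_form u v w : (v^T *m (u *m u^T) *m w) 0 0 =
  (v^T *m u) 0 0 * (w^T *m u) 0 0.
Proof.
rewrite mulmxA -mulmxA -[u^T *m w]mx11_tr trmx_mul trmxK mxE.
by rewrite big_ord1.
Qed.

(** One step of symmetric elimination: [u] is column [K] over the root of the pivot. A zero pivot
    forces row [K] to vanish, by Cauchy-Schwarz on entries. The last clause keeps rows cleared
    earlier at zero. *)
Lemma psd_sub_outer A (K : 'I_r) : psd A -> exists u : 'cV[R]_r,
  [/\ psd (A - u *m u^T), forall j, (A - u *m u^T) K j = 0 &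
      forall i, A i K = 0 -> u i 0 = 0].
Proof.
move=> pA; have [sA qA] := pA.
have [A0|A0] := eqVneq (A K K) 0.
  exists 0; rewrite mul0mx subr0; split=> // [j|i _]; last by rewrite mxE.
  have := psd_entry_sqr K j pA.
  rewrite A0 mul0r => /(conj (sqr_ge0 _))/andP/le_anti/esym/eqP.
  by rewrite sqrf_eq0 => /eqP.
have Ap : 0 < A K K by rewrite lt_neqAle eq_sym A0 psd_diag_ge0.
pose q := Num.sqrt (A K K).
have q2 : q ^+ 2 = A K K by rewrite sqr_sqrtr// ltW.
have q0 : q != 0 by rewrite -sqrf_eq0 q2.
exists (q^-1 *: col K A).
have uE i : (q^-1 *: col K A) i 0 = q^-1 * A i K by rewrite !mxE.
set u := q^-1 *: _ in uE *.
have uuE i j : (u *m u^T) i j = A i K * A j K / A K K.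
  by rewrite mxE big_ord1 [X in _ * X]mxE !uE -q2; field.
split; last by move=> i h; rewrite uE h mulr0.
  split=> [|v]; first by rewrite linearB/= trmx_mul trmxK sA.
  rewrite mulmxBr mulmxBl mxE [X in _ + X]mxE outer_form.
  have -> : (v^T *m u) 0 0 = q^-1 * (v^T *m A *m (delta_mx K 0 : 'cV_r)) 0 0.
    by rewrite -mulmxA -colE -scalemxAr mxE.
  set w := (_ *m (delta_mx K 0 : 'cV_r)) 0 0.
  have -> : q^-1 * w * (q^-1 * w) = w ^+ 2 / A K K by rewrite -q2; field.
  rewrite subr_ge0 ler_pdivrMr//.
  by have := psd_CauchySchwarz v (delta_mx K 0) pA; rewrite delta_form.
move=> j; rewrite mxE [X in _ + X]mxE uuE -{1}sA mxE; by field.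
Qed.

(** Cholesky factorization, singular matrices included: after [m] eliminations the first [m] rows of
    the remainder vanish. *)
Lemma psd_sum_outer A : psd A ->
  exists u : 'I_r -> 'cV[R]_r, A = \sum_k u k *m (u k)^T.
Proof.
move=> pA.
have partial m : (m <= r)%N -> exists u : 'I_r -> 'cV[R]_r,
    psd (A - \sum_(k < r | (k < m)%N) u k *m (u k)^T) /\
    forall i j : 'I_r, (i < m)%N ->
      (A - \sum_(k < r | (k < m)%N) u k *m (u k)^T) i j = 0.
  elim: m => [_|m IH mr]; first by exists (fun=> 0); rewrite big_pred0// subr0.
  have [u [pu u0]] := IH (ltnW mr).
  pose K := Ordinal mr.
  have [v [pv v0 vi]] := psd_sub_outer K pu.
  exists (fun k => if k == K then v else u k).
  have -> : \sum_(k < r | (k < m.+1)%N)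
      (if k == K then v else u k) *m (if k == K then v else u k)^T =
    \sum_(k < r | (k < m)%N) u k *m (u k)^T + v *m v^T.
    rewrite (bigD1 K)//= eqxx addrC; congr (_ + _); apply: eq_big => k.
      by rewrite ltnS [RHS]ltn_neqAle andbC.
    by move=> /andP[_ /negPf->].
  rewrite opprD addrA; split=> // i j; rewrite ltnS leq_eqVlt => /orP[/eqP iK|im].
    by have -> : i = K by exact: val_inj.
  rewrite mxE [X in _ + X]mxE u0// mxE big_ord1 vi ?mul0r ?oppr0 ?addr0//.
  exact: u0.
have [u [_ h]] := partial r (leqnn r).
exists u; apply/eqP; rewrite -subr_eq0; apply/eqP/matrixP => i j.
rewrite [RHS]mxE -(h i j)//.
by congr ((A - _) i j); apply: eq_bigl => k; rewrite ltn_ord.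
Qed.

Lemma psd_factor A : psd A -> exists G : 'M[R]_r, A = G *m G^T.
Proof.
move=> /psd_sum_outer[u ->]; exists (\matrix_(i, k) u k i 0).
apply/matrixP => i j; rewrite summxE !mxE; apply: eq_bigr => k _.
by rewrite !mxE big_ord1 !mxE.
Qed.

Lemma psd_det_ge0 A : psd A -> 0 <= \det A.
Proof. by move=> /psd_factor[G ->]; rewrite det_mulmx det_tr -expr2 sqr_ge0. Qed.

Lemma psd_tr_ge0 A : psd A -> 0 <= \tr A.
Proof. by move=> pA; apply: sumr_ge0 => i _; exact: psd_diag_ge0. Qed.

Lemma psd_trM_ge0 A B : psd A -> psd B -> 0 <= \tr (A *m B).
Proof.
move=> /psd_factor[G ->] pB; rewrite -mulmxA mxtrace_mulC.
by apply: psd_tr_ge0; have := psd_conj G^T pB; rewrite trmxK.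
Qed.

(** The claim is additive over outer products, and for one of them it is Cauchy-Schwarz in the
    standard inner product. *)
Lemma psd_le_tr A : psd A -> psd ((\tr A)%:M - A).
Proof.
move=> /psd_sum_outer[u ->].
have -> : (\tr (\sum_k u k *m (u k)^T))%:M - \sum_k u k *m (u k)^T =
    \sum_k ((\tr (u k *m (u k)^T))%:M - u k *m (u k)^T).
  by rewrite sumrB [\tr _]raddf_sum raddf_sum.
apply: psd_sum => k _; split.
  by rewrite linearB/= tr_scalar_mx trmx_mul trmxK.
move=> v; rewrite mulmxBr mulmxBl mxE [X in _ + X]mxE outer_form.
rewrite mxtrace_mulC mul_mx_scalar -scalemxAl mxE subr_ge0 [\tr _]big_ord1.
by have := psd_CauchySchwarz v (u k) psd1; rewrite !mulmx1 mulrC expr2.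
Qed.

End Fixed_size.
End PositiveSemidefinite.

(** Multiplying the bordered matrix [M] by the unipotent [P] on the left and on the right exposes
    its two Schur complements. *)
Lemma det_1B_outer (F : fieldType) (r : nat) (a b : 'cV[F]_r) :
  \det (1%:M - a *m b^T) = 1 - (b^T *m a) 0 0.
Proof.
pose M := block_mx (1%:M : 'M[F]_1) b^T a (1%:M : 'M[F]_r).
pose P : 'M[F]_(1 + r) := block_mx 1%:M 0 (- a) 1%:M.
have dP : \det P = 1 by rewrite det_lblock !det1 mulr1.
have d1 : \det M = \det (1%:M - a *m b^T).
  have := det_mulmx P M; rewrite dP mul1r => <-; rewrite mulmx_block !mul1mx !mul0mx !addr0 mulmx1.
  by rewrite addNr mulNmx addrC det_ublock det1 mul1r.
have d2 : \det M = \det (1%:M - b^T *m a).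
  have := det_mulmx M P; rewrite dP mulr1 => <-; rewrite mulmx_block !mulmx1 !mulmx0 !add0r mul1mx.
  by rewrite subrr mulmxN det_ublock det1 mulr1.
by rewrite -d1 d2 det_mx11 !mxE.
Qed.

Lemma det_sub_outer (F : fieldType) (r : nat) (A : 'M[F]_r) (u : 'cV[F]_r) :
  A \in unitmx ->
  \det (A - u *m u^T) = \det A * (1 - (u^T *m invmx A *m u) 0 0).
Proof.
move=> uA; rewrite -mulmxA -det_1B_outer -det_mulmx.
by rewrite mulmxBr mulmx1 !mulmxA mulmxV// mul1mx.
Qed.

(** * Simultaneous rescaling of a family of psd matrices *)

Section Rescaling.
Variables (R : realType) (r : nat).
Implicit Types (A B W L : 'M[R]_r) (u v : 'cV[R]_r).

Lemma psd_unitmx (d : R) A : 0 < d -> psd A -> d%:M + A \in unitmx.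
Proof.
move=> d0 [sA pA]; rewrite -row_free_unit -kermx_eq0; apply/eqP/row_matrixP => i.
rewrite row0; set w := row i _.
have w0 : w *m (d%:M + A) = 0 by rewrite -row_mul mulmx_ker row0.
have : (w *m (d%:M + A) *m w^T) 0 0 = 0 by rewrite w0 mul0mx mxE.
rewrite mulmxDr mulmxDl mxE mul_mx_scalar -scalemxAl mxE.
have := pA w^T; rewrite trmxK; set q := (w *m A *m _) 0 0 => q0 e.
have n0 : 0 <= (w *m w^T) 0 0.
  by have [_ /(_ w^T)] := psd1 R r; rewrite trmxK mulmx1.
have {e} : (w *m w^T) 0 0 = 0.
  apply: le_anti; rewrite n0 andbT -(ler_pM2l d0) mulr0 -(lerD2r q) e add0r.
  exact: q0.
rewrite mxE => /eqP; rewrite psumr_eq0 => [/allP h|j _].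
  apply/rowP => j; have := h j; rewrite mem_index_enum => /(_ isT)/implyP/(_ isT).
  by rewrite [X in _ * X]mxE -expr2 sqrf_eq0 [RHS]mxE => /eqP.
by rewrite [X in _ * X]mxE -expr2 sqr_ge0.
Qed.

Lemma psd_inv A : A \in unitmx -> psd A -> psd (invmx A).
Proof.
move=> uA pA; have := psd_conj (invmx A) pA; case: (pA) => sA _.
by rewrite mulVmx// mul1mx trmx_inv sA.
Qed.

(** As [W - u u^T = A - 2 u u^T], it suffices that [(v . u)^2 <= (v^T A v) / 2], which is
    Cauchy-Schwarz for the form [A] at [A^-1 u] and [v]. *)
Lemma psd_sub_half W u (A := W + u *m u^T) : A \in unitmx -> psd W ->
  (u^T *m invmx A *m u) 0 0 <= 2^-1 -> psd (W - u *m u^T).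
Proof.
move=> uA pW h; have pA : psd A by apply: psdD pW _; exact: psd_mul_tr.
have [sA qA] := pA; have [sW _] := pW.
split=> [|v]; first by rewrite linearB/= trmx_mul trmxK sW.
have -> : W - u *m u^T = A - 2 *: (u *m u^T).
  by rewrite /A scaler_nat mulr2n opprD addrA addrK.
rewrite mulmxBr mulmxBl -scalemxAr -scalemxAl mxE [X in _ + X]mxE [X in - X]mxE outer_form.
have := psd_CauchySchwarz (invmx A *m u) v pA.
rewrite trmx_mul trmx_inv sA.
have -> : u^T *m invmx A *m A *m v = (v^T *m u)^T.
  by rewrite -(mulmxA u^T) mulVmx// mulmx1 trmx_mul trmxK.
have -> : u^T *m invmx A *m A *m (invmx A *m u) = u^T *m invmx A *m u.
  by rewrite mulmxA -(mulmxA _ A) mulmxV// mulmx1.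
rewrite mx11_tr => cs; rewrite subr_ge0 -expr2.
rewrite -ler_pdivlMl//; apply: le_trans cs _.
by rewrite ler_wpM2r.
Qed.

(* The [2 r] vectors maximize the determinant of [W]: exchanging one of them for
   [u i] does not increase it, so each of them has in the metric [W + u u^T]
   at least the squared length of [u i], whereas these lengths sum to at most [r]. *)
Lemma max_det_majorant (I : finType) (i0 : I) (u : I -> 'cV[R]_r) (d : R) : 0 < d ->
  exists t : {ffun 'I_(2 * r) -> I},
  forall i, psd (d%:M + \sum_k u (t k) *m (u (t k))^T - u i *m (u i)^T).
Proof.
move=> d0; pose W (t : {ffun 'I_(2 * r) -> I}) := d%:M + \sum_k u (t k) *m (u (t k))^T.
have [t _ tmax] := @arg_maxP _ _ _ [ffun=> i0] predT (fun t => \det (W t)) isT.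
exists t => i; rewrite -/(W t).
have pd : psd (d%:M : 'M[R]_r).
  by rewrite -[d]mulr1 -scale_scalar_mx; apply: psdZ (ltW d0) (psd1 _ _).
have pS (P : pred 'I_(2 * r)) (s : {ffun 'I_(2 * r) -> I}) :
    psd (\sum_(k | P k) u (s k) *m (u (s k))^T).
  by apply: psd_sum => k _; exact: psd_mul_tr.
have pW s : psd (W s) by exact: psdD.
pose A := W t + u i *m (u i)^T.
have uA : A \in unitmx.
  by rewrite /A /W -addrA; apply: psd_unitmx d0 (psdD _ _) => //; exact: psd_mul_tr.
have pA : psd A by apply: psdD => //; exact: psd_mul_tr.
apply: psd_sub_half => //; rewrite -/A.
have lenE v : (v^T *m invmx A *m v) 0 0 = \tr (invmx A *m (v *m v^T)).
  by rewrite mulmxA mxtrace_mulC mulmxA [RHS]big_ord1.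
have detA : 0 < \det A.
  by rewrite lt_neqAle eq_sym psd_det_ge0// andbT -unitfE -unitmxE.
pose w := (fun v : 'cV[R]_r => (v^T *m invmx A *m v) 0 0).
(* Both determinants are rank-one downdates of the same [A], so maximality of [t] compares the two
   lengths. *)
have exch k : w (u i) <= w (u (t k)).
  pose s := [ffun l => if l == k then i else t l].
  have e : A - u (t k) *m (u (t k))^T = W s.
    rewrite /A /W (bigD1 k)//= [in RHS](bigD1 k)//= !ffunE eqxx.
    under [in RHS]eq_bigr => l /negPf lk do rewrite ffunE lk.
    move: (d%:M) (\sum_(l | _) _) => a b.
    move: (u (t k) *m _) (u i *m _) => c e.
    by rewrite (addrCA a) -(addrA c) [LHS]addrC addKr -addrA (addrC b).
  have /= := tmax s isT; rewrite -e det_sub_outer//.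
  have -> : W t = A - u i *m (u i)^T by rewrite /A addrK.
  rewrite det_sub_outer//. by rewrite ler_pM2l// lerD2l lerN2.
have total : w (u i) + \sum_k w (u (t k)) <= r%:R.
  rewrite /w lenE; under eq_bigr do rewrite lenE.
  rewrite -raddf_sum -mulmx_sumr -raddfD/= -mulmxDr.
  have -> : u i *m (u i)^T + \sum_k u (t k) *m (u (t k))^T = A - d%:M.
    by rewrite /A /W -(addrA d%:M) [RHS]addrC addKr addrC.
  rewrite mulmxBr mulVmx// linearB/= mxtrace1 gerBl.
  by apply: psd_trM_ge0 => //; exact: psd_inv.
(* The least of [2 r + 1] lengths of total at most [r] is below 1/2, the threshold of
   [psd_sub_half]. *)
have : w (u i) *+ (2 * r).+1 <= r%:R.
  apply: le_trans total; rewrite mulrS lerD2l -[X in _ *+ X]card_ord -sumr_const.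
  by apply: ler_sum => k _.
rewrite -mulr_natr => h.
have h2 : w (u i) * (2 * r).+1%:R <= 2^-1 * (2 * r).+1%:R.
  have -> : (2 * r).+1%:R = 2 * r%:R + 1 :> R by rewrite -addn1 natrD natrM.
  by move: h; rewrite -addn1 natrD natrM; lra.
by move: h2; rewrite ler_pM2r.
Qed.

End Rescaling.

(** The form [M + W / (2 r)] becomes the identity, where [M] is the mean of the [L i] and [W]
    dominates each rank-one piece of each [L i]. So the mean is at most 1, and [L i <= r W] gives
    [2 r^2]. Against [Q] the trace of [W] stays small, because [W] consists of [2 r] such pieces and
    a small multiple of 1. *)
Lemma psd_family_rescale (R : realType) (r : nat) (I X : finType) (i0 : I)
    (L : I -> 'M[R]_r) (Q : X -> 'M[R]_r) : (0 < r)%N ->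
  (forall i, psd (L i)) -> (forall x, psd (Q x)) ->
  (forall i x, \tr (L i *m Q x) <= 2) ->
  exists G H : 'M[R]_r,
  [/\ G *m H = 1%:M,
      psd (1%:M - #|I|%:R^-1 *: \sum_i G *m L i *m G^T),
      forall i, psd ((2 * r%:R ^+ 2)%:M - G *m L i *m G^T) &
      forall x, \tr (H^T *m Q x *m H) <= 5].
Proof.
move=> r0 pL pQ LQ.
have rR : 0 < r%:R :> R by rewrite ltr0n.
have /fin_all_exists[u uE] (i : I) : exists v : 'I_r -> 'cV[R]_r,
    L i = \sum_k v k *m (v k)^T by exact: psd_sum_outer.
(* So small that the term [d] of [W] contributes at most 1 to each trace. *)
pose d : R := (1 + \sum_x \tr (Q x))^-1.
have S0 : 0 <= \sum_x \tr (Q x) by apply: sumr_ge0 => x _; exact: psd_tr_ge0.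
have d0 : 0 < d by rewrite invr_gt0 ltr_wpDr.
have dQ x : d * \tr (Q x) <= 1.
  rewrite mulrC ler_pdivrMr ?ltr_wpDr// mul1r (bigD1 x)//=.
  rewrite addrCA lerDl addr_ge0// sumr_ge0// => y _; exact: psd_tr_ge0.
have [t tP] := max_det_majorant (i0, Ordinal r0) (fun p => u p.1 p.2) d0.
set W := _ + _ in tP.
have LW i : psd (r%:R *: W - L i).
  have -> : r%:R *: W - L i = \sum_k (W - u i k *m (u i k)^T).
    by rewrite sumrB -uE sumr_const card_ord scaler_nat.
  by apply: psd_sum => k _; exact: (tP (i, k)).
have pS : psd (\sum_k u (t k).1 (t k).2 *m (u (t k).1 (t k).2)^T).
  by apply: psd_sum => k _; exact: psd_mul_tr.
have pd (a : R) : 0 <= a -> psd (a%:M : 'M[R]_r).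
  by move=> a0; rewrite -[a]mulr1 -scale_scalar_mx; exact: psdZ (psd1 _ _).
have pW : psd W by apply: psdD pS; apply: pd; exact: ltW.
pose M := #|I|%:R^-1 *: \sum_i L i.
have pM : psd M by apply: psdZ; [rewrite invr_ge0|exact: psd_sum].
pose c : R := (2 * r%:R)^-1.
have c0 : 0 < c by rewrite invr_gt0 mulr_gt0.
have pMW : psd (M + c *: W) by apply: psdD => //; apply: psdZ => //; exact: ltW.
have uMW : M + c *: W \in unitmx.
  rewrite addrC scalerDr -addrA scale_scalar_mx psd_unitmx ?mulr_gt0//.
  by apply: psdD => //; apply: psdZ => //; exact: ltW.
have [H HE] := psd_factor pMW.
have uH : H \in unitmx by move: uMW; rewrite HE unitmx_mul => /andP[].
exists (invmx H), H; split; first exact: mulVmx.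
- have -> : 1%:M = invmx H *m (M + c *: W) *m (invmx H)^T.
    by rewrite HE mulmxA mulVmx// mul1mx -trmx_mul mulVmx// trmx1.
  rewrite -mulmx_suml -mulmx_sumr scalemxAl scalemxAr -/M -mulmxBl -mulmxBr.
  by apply: psd_conj; rewrite addrAC subrr add0r; apply: psdZ => //; exact: ltW.
- move=> i; have -> : (2 * r%:R ^+ 2)%:M =
      invmx H *m ((2 * r%:R ^+ 2) *: (M + c *: W)) *m (invmx H)^T.
    rewrite -scalemxAr -scalemxAl HE mulmxA mulVmx// mul1mx -trmx_mul mulVmx//.
    by rewrite trmx1 scale_scalar_mx mulr1.
  rewrite -mulmxBl -mulmxBr; apply: psd_conj; rewrite scalerDr -addrA.
  apply: psdD; first by apply: psdZ pM; rewrite mulr_ge0// sqr_ge0.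
  rewrite scalerA (_ : _ * c = r%:R)//.
  by rewrite /c; field; rewrite gt_eqF.
move=> x; rewrite mxtrace_mulC mulmxA -HE mulmxDl mxtraceD.
have MQ : \tr (M *m Q x) <= 2.
  rewrite -scalemxAl mxtraceZ mulmx_suml raddf_sum/=.
  have I0 : (0 < #|I|)%N by apply/card_gt0P; exists i0.
  rewrite ler_pdivrMl ?ltr0n//.
  apply: le_trans (_ : \sum_(i : I) 2 <= _); first exact: ler_sum.
  by rewrite sumr_const mulr_natl.
(* [tr (W Q) <= 1 + 4 r <= 6 r], as each of the [2 r] pieces of [W] lies below some [L i]. *)
have cW : \tr (c *: W *m Q x) <= 3.
  rewrite -scalemxAl mxtraceZ mulrC ler_pdivrMr ?mulr_gt0//.
  rewrite mulmxDl mxtraceD mul_scalar_mx mxtraceZ mulmx_suml raddf_sum/=.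
  apply: le_trans (_ : 1 + \sum_(k < 2 * r) 2 <= _).
    apply: lerD (dQ x) _; apply: ler_sum => k _.
    apply: le_trans (LQ (t k).1 x); rewrite [in leRHS]uE mulmx_suml raddf_sum/=.
    rewrite (bigD1 (t k).2)//= lerDl sumr_ge0// => l _.
    by apply: psd_trM_ge0 => //; exact: psd_mul_tr.
  rewrite sumr_const card_ord.
  have -> : 2 *+ (2 * r) = 4 * r%:R :> R by rewrite -[LHS]mulr_natr natrM; ring.
  have : 1 <= r%:R :> R by rewrite ler1n.
  by lra.
by lra.
Qed.

(** * Fourier expansion on the cube *)

Section Fourier.
Variables (R : realFieldType) (I : finType).
Local Notation boolcube := {ffun I -> bool}.
Implicit Types (T U : {set I}) (x y : boolcube) (f g : boolcube -> R).

Definition chi T x : R := \prod_(i in T) (-1) ^+ x i.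

Definition fourier f T : R := (\sum_x f x * chi T x) / 2 ^+ #|I|.

(** Degree in the characters, which agrees with the multilinear degree because [(-1)^x = 1 - 2 x] on
    bits; orthogonality makes it suited to mean squares. *)
Definition lowdeg (e : nat) f := forall T, (e < #|T|)%N -> fourier f T = 0.

Lemma two_neq0 n : 2 ^+ n != 0 :> R.
Proof. by rewrite expf_neq0// pnatr_eq0. Qed.

Lemma chiE T x : chi T x = \prod_i (if i \in T then (-1) ^+ x i else 1).
Proof. by rewrite /chi big_mkcond. Qed.

Lemma chi0 x : chi finset.set0 x = 1.
Proof. by rewrite /chi big_set0. Qed.

Lemma chi_sqr T x : chi T x ^+ 2 = 1.
Proof.
by rewrite /chi -prodrXl big1// => i _; rewrite sqrr_sign.
Qed.

Lemma chiM T U x : chi T x * chi U x = chi ((T :\: U) :|: (U :\: T)) x.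
Proof.
rewrite !chiE -big_split/=; apply: eq_bigr => i _; rewrite !inE.
by case: (i \in T); case: (i \in U); rewrite /= ?mulr1 ?mul1r// -expr2 sqrr_sign.
Qed.

Lemma sum_chiM T U : \sum_x chi T x * chi U x = (T == U)%:R * 2 ^+ #|I|.
Proof.
pose F i (b : bool) : R :=
  (if i \in T then (-1) ^+ b else 1) * (if i \in U then (-1) ^+ b else 1).
have -> : \sum_x chi T x * chi U x = \sum_(x : boolcube) \prod_i F i (x i).
  by apply: eq_bigr => x _; rewrite !chiE -big_split.
rewrite -bigA_distr_bigA/=.
have FE i : \sum_b F i b = ((i \in T) == (i \in U))%:R * 2.
  rewrite big_bool /F; case: (i \in T); case: (i \in U) => /=;
    rewrite ?expr1 ?expr0; ring.
under eq_bigr do rewrite FE.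
rewrite big_split/= prodr_const cardT -cardE; congr (_ * _).
have [->|TU] := eqVneq T U; first by rewrite big1// => i _; rewrite eqxx.
have [i iTU] : exists i, (i \in T) != (i \in U).
  apply/existsP; rewrite -negb_forall; apply: contra TU => /forallP h.
  by apply/eqP/setP => i; apply/eqP.
by rewrite (bigD1 i)//= (negPf iTU) mul0r.
Qed.

Lemma sum_set_chiM x y : \sum_T chi T x * chi T y = (x == y)%:R * 2 ^+ #|I|.
Proof.
pose s i : R := (-1) ^+ x i * (-1) ^+ y i.
have -> : \sum_T chi T x * chi T y = \prod_i (s i + 1).
  rewrite bigA_distr/=; apply: eq_bigr => T _; rewrite !chiE -big_split/=.
  by apply: eq_bigr => i _; case: ifP; rewrite ?mulr1.
have sE i : s i + 1 = (x i == y i)%:R * 2.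
  by rewrite /s; case: (x i); case: (y i) => /=; rewrite ?expr1 ?expr0; ring.
under eq_bigr do rewrite sE.
rewrite big_split/= prodr_const cardT -cardE; congr (_ * _).
have [->|xy] := eqVneq x y; first by rewrite big1// => i _; rewrite eqxx.
have [i ixy] : exists i, x i != y i.
  apply/existsP; rewrite -negb_forall; apply: contra xy => /forallP h.
  by apply/eqP/ffunP => i; apply/eqP.
by rewrite (bigD1 i)//= (negPf ixy) mul0r.
Qed.

Lemma fourier_inv f x : f x = \sum_T fourier f T * chi T x.
Proof.
rewrite /fourier; under eq_bigr do rewrite mulrAC mulr_suml.
rewrite -mulr_suml exchange_big/=.
have -> : \sum_y \sum_T f y * chi T y * chi T x = f x * 2 ^+ #|I|.
  under eq_bigr => y _.
    under eq_bigr do rewrite -mulrA.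
    rewrite -mulr_sumr sum_set_chiM; over.
  rewrite (bigD1 x)//= eqxx mul1r big1 ?addr0// => y /negPf->.
  by rewrite mul0r mulr0.
by rewrite mulfK// two_neq0.
Qed.

Lemma fourier_synth (a : {set I} -> R) U : fourier (fun x => \sum_T a T * chi T x) U = a U.
Proof.
rewrite /fourier; under eq_bigr do rewrite mulr_suml.
rewrite exchange_big/=.
have -> : \sum_T \sum_x a T * chi T x * chi U x = a U * 2 ^+ #|I|.
  under eq_bigr => T _.
    under eq_bigr do rewrite -mulrA.
    rewrite -mulr_sumr sum_chiM; over.
  rewrite (bigD1 U)//= eqxx mul1r big1 ?addr0// => T /negPf->.
  by rewrite mul0r mulr0.
by rewrite mulfK// two_neq0.
Qed.

Lemma eq_fourier f g T : f =1 g -> fourier f T = fourier g T.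
Proof. by move=> fg; congr (_ / _); apply: eq_bigr => x _; rewrite fg. Qed.

Lemma parseval f : \sum_x f x ^+ 2 = 2 ^+ #|I| * \sum_T fourier f T ^+ 2.
Proof.
under eq_bigr => x _ do rewrite expr2 [X in _ * X]fourier_inv mulr_sumr.
rewrite exchange_big/= mulr_sumr; apply: eq_bigr => T _.
under eq_bigr do rewrite mulrCA.
rewrite -mulr_sumr -[X in _ * X = _](@mulfVK _ (2 ^+ #|I|)) ?two_neq0//.
by rewrite -/(fourier f T) mulrA -expr2 mulrC.
Qed.

Lemma lowdegW d e f : (d <= e)%N -> lowdeg d f -> lowdeg e f.
Proof. by move=> de lf T /(leq_ltn_trans de)/lf. Qed.

Lemma eq_lowdeg e f g : lowdeg e f -> f =1 g -> lowdeg e g.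
Proof. by move=> lf fg T eT; rewrite -(eq_fourier T fg) lf. Qed.

Lemma lowdegD e f g : lowdeg e f -> lowdeg e g -> lowdeg e (fun x => f x + g x).
Proof.
move=> lf lg T eT; rewrite /fourier; under eq_bigr do rewrite mulrDl.
by rewrite big_split/= mulrDl -!/(fourier _ _) lf// lg// addr0.
Qed.

Lemma lowdegZ e (a : R) f : lowdeg e f -> lowdeg e (fun x => a * f x).
Proof.
move=> lf T eT; rewrite /fourier; under eq_bigr do rewrite -mulrA.
by rewrite -mulr_sumr -mulrA -/(fourier _ _) lf// mulr0.
Qed.

Lemma lowdeg_chi e T : (#|T| <= e)%N -> lowdeg e (chi T).
Proof.
move=> Te U eU; rewrite /fourier sum_chiM (_ : T == U = false) ?mul0r//.
by apply: contraTF eU => /eqP<-; rewrite -leqNgt.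
Qed.

Lemma lowdeg_cst e (a : R) : lowdeg e (fun=> a).
Proof.
have l0 : lowdeg e (chi finset.set0) by apply: lowdeg_chi; rewrite cards0.
by apply: eq_lowdeg (lowdegZ a l0) _ => x; rewrite chi0 mulr1.
Qed.

Lemma lowdeg_sum e (K : Type) (s : seq K) (P : pred K) (F : K -> boolcube -> R) :
  (forall k, P k -> lowdeg e (F k)) -> lowdeg e (fun x => \sum_(k <- s | P k) F k x).
Proof.
move=> h; elim: s => [|k s IH].
  by apply: eq_lowdeg (lowdeg_cst 0) _ => x; rewrite big_nil.
have [Pk|Pk] := boolP (P k).
  by apply: eq_lowdeg (lowdegD (h k Pk) IH) _ => x; rewrite big_cons Pk.
by apply: eq_lowdeg IH _ => x; rewrite big_cons (negPf Pk).
Qed.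

(** The product of two characters is the character of the symmetric difference. *)
Lemma lowdegM a b f g :
  lowdeg a f -> lowdeg b g -> lowdeg (a + b) (fun x => f x * g x).
Proof.
move=> lf lg.
apply: (@eq_lowdeg _ (fun x => \sum_T \sum_U fourier f T * fourier g U *
    chi ((T :\: U) :|: (U :\: T)) x)); last first.
  move=> x; rewrite [in RHS](fourier_inv f) [in RHS](fourier_inv g) mulr_suml.
  apply: eq_bigr => T _; rewrite mulr_sumr; apply: eq_bigr => U _.
  by rewrite -chiM mulrACA.
apply: lowdeg_sum => T _; apply: lowdeg_sum => U _.
have [Ta|/lf->] := leqP #|T| a; last first.
  by apply: eq_lowdeg (lowdeg_cst 0) _ => x; rewrite !mul0r.
have [Ub|/lg->] := leqP #|U| b; last first.
  by apply: eq_lowdeg (lowdeg_cst 0) _ => x; rewrite mulr0 mul0r.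
apply: lowdegZ; apply: lowdeg_chi; apply: leq_trans (leq_add Ta Ub).
by apply: leq_trans (leq_card_setU _ _) _; rewrite leq_add// subset_leq_card// subsetDl.
Qed.

End Fourier.

(** * Restriction to a subset of the coordinates *)

Section Restriction.
Variables (R : realFieldType) (I J : finType) (s : J -> I).
Hypothesis s_inj : injective s.
Implicit Types (T : {set I}) (U : {set J}).
Implicit Types (x z : {ffun I -> bool}) (y w : {ffun J -> bool}).

Definition restr x : {ffun J -> bool} := [ffun j => x (s j)].

Definition emb y : {ffun I -> bool} := [ffun i => [exists j, (s j == i) && y j]].

Definition xorf {K : finType} (x z : {ffun K -> bool}) : {ffun K -> bool} :=
  [ffun i => x i (+) z i].

Lemma xorfK (K : finType) (z : {ffun K -> bool}) : involutive (xorf^~ z).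
Proof. by move=> x; apply/ffunP => i; rewrite !ffunE addbK. Qed.

Lemma chi_xorf (K : finType) (T : {set K}) (a c : {ffun K -> bool}) :
  chi R T (xorf a c) = chi R T a * chi R T c.
Proof.
by rewrite /chi -big_split/=; apply: eq_bigr => i _; rewrite ffunE signr_addb.
Qed.

Lemma emb_inj j y : emb y (s j) = y j.
Proof.
rewrite ffunE; apply/existsP/idP => [[k /andP[/eqP/s_inj->]]//|yj].
by exists j; rewrite eqxx.
Qed.

Lemma chi_restr U x : chi R U (restr x) = chi R (s @: U) x.
Proof.
rewrite /chi big_imset/=; last by move=> ? ? _ _; exact: s_inj.
by apply: eq_bigr => j _; rewrite ffunE.
Qed.

Lemma chi_emb T y : chi R T (emb y) = chi R (s @^-1: T) y.
Proof.
have {2}-> : y = restr (emb y) by apply/ffunP => j; rewrite ffunE emb_inj.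
rewrite chi_restr /chi (big_setID (s @: [set: J]))/= [X in _ * X]big1 => [|i].
  rewrite mulr1; apply: eq_bigl => i; rewrite inE andbC.
  apply/andP/imsetP => [[/imsetP[j _ ->] jT]|[j jT ->]].
    by exists j => //; rewrite inE.
  by rewrite inE in jT; split=> //; exact: imset_f.
rewrite inE => /andP[iJ _]; rewrite ffunE; case: existsP => //= -[j /andP[/eqP ji _]].
by move: iJ; rewrite -ji imset_f.
Qed.

Lemma lowdeg_restr (f : {ffun J -> bool} -> R) : lowdeg #|J| (fun x => f (restr x)).
Proof.
apply: (@eq_lowdeg _ _ _ (fun x => \sum_U fourier f U * chi R (s @: U) x)); last first.
  by move=> x; rewrite [RHS]fourier_inv; apply: eq_bigr => U _; rewrite chi_restr.
apply: lowdeg_sum => U _; apply: lowdegZ; apply: lowdeg_chi.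
by apply: leq_trans (leq_imset_card _ _) (max_card _).
Qed.

(** Translation by [emb y] permutes the cube. The inner sum runs over a fibre on which the
    coordinates outside the image of [s] are frozen. *)
Lemma sum_xorf_emb (F : {ffun I -> bool} -> R) :
  2 ^+ #|J| * \sum_x F x = \sum_x \sum_y F (xorf x (emb y)).
Proof.
rewrite exchange_big/=.
under [RHS]eq_bigr => y _.
  rewrite -(reindex_inj (h := xorf^~ (emb y)) (P := predT) (F := F)); last first.
    exact: inv_inj (xorfK _).
  over.
by rewrite sumr_const card_ffun card_bool -[RHS]mulr_natl natrX.
Qed.

Lemma restr_xorf_emb x y : restr (xorf x (emb y)) = xorf y (restr x).
Proof. by apply/ffunP => j; rewrite !ffunE -emb_inj ffunE addbC. Qed.

(** The fibres of the restriction have equal size; the cleared form avoids the exponent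
    [#|I| - #|J|]. *)
Lemma sum_restr (F : {ffun J -> bool} -> R) :
  2 ^+ #|J| * \sum_x F (restr x) = 2 ^+ #|I| * \sum_y F y.
Proof.
rewrite (sum_xorf_emb (fun x => F (restr x))).
under eq_bigr => x _.
  under eq_bigr do rewrite restr_xorf_emb.
  rewrite -(reindex_inj (h := xorf^~ (restr x)) (P := predT) (F := F)); last first.
    exact: inv_inj (xorfK _).
  over.
by rewrite sumr_const card_ffun card_bool -[LHS]mulr_natl natrX.
Qed.

(** Degree is counted only in the coordinates seen by [s], because the others are frozen when [D]
    tests the function. *)
Definition low_part (e : nat) (f : {ffun I -> bool} -> R) x : R :=
  \sum_(T : {set I} | (#|s @^-1: T| <= e)%N) fourier f T * chi R T x.

Definition high_part (e : nat) (f : {ffun I -> bool} -> R) x : R :=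
  \sum_(T : {set I} | (e < #|s @^-1: T|)%N) fourier f T * chi R T x.

Lemma low_highE e f x : f x = low_part e f x + high_part e f x.
Proof.
rewrite fourier_inv (bigID (fun T : {set I} => (#|s @^-1: T| <= e)%N))/=; congr (_ + _).
by apply: eq_bigl => T; rewrite ltnNge.
Qed.

Lemma sum_high_part e f : \sum_x high_part e f x ^+ 2 =
  2 ^+ #|I| * \sum_(T : {set I} | (e < #|s @^-1: T|)%N) fourier f T ^+ 2.
Proof.
rewrite parseval [in RHS]big_mkcond; congr (_ * _); apply: eq_bigr => U _.
rewrite (@eq_fourier _ _ _ (fun x => \sum_(T : {set I})
  (if (e < #|s @^-1: T|)%N then fourier f T else 0) * chi R T x)).
  by rewrite fourier_synth; case: ifP => // _; rewrite expr0n.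
move=> x; rewrite /high_part big_mkcond; apply: eq_bigr => T _.
by case: ifP => // _; rewrite mul0r.
Qed.

Variables (e : nat) (D : {ffun J -> bool} -> R).
Hypothesis D_sqr_ge0 : forall g, lowdeg e g -> 0 <= \sum_y D y * g y ^+ 2.

(* Once the coordinates outside the image of [s] are fixed, the low part is a
   function of degree [e] of the remaining ones. *)
Lemma low_part_ge0 f : 0 <= \sum_x D (restr x) * low_part e f x ^+ 2.
Proof.
rewrite -(pmulr_rge0 _ (exprn_gt0 #|J| (ltr0n R 2))).
rewrite (sum_xorf_emb (fun x => D (restr x) * low_part e f x ^+ 2)).
apply: sumr_ge0 => x _.
(* The argument agrees with [x] off the image of [s] and restricts to [y] on it. *)
pose g y := low_part e f (xorf x (emb (xorf y (restr x)))).
have lg : lowdeg e g.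
  apply: (@eq_lowdeg _ _ _ (fun y => \sum_(T : {set I} | (#|s @^-1: T| <= e)%N)
    (fourier f T * (chi R T x * chi R (s @^-1: T) (restr x))) * chi R (s @^-1: T) y)).
    by apply: lowdeg_sum => T Te; apply: lowdegZ; exact: lowdeg_chi.
  move=> y; apply: eq_bigr => T _; rewrite chi_xorf chi_emb chi_xorf; ring.
have := D_sqr_ge0 lg.
rewrite (reindex_inj (h := xorf^~ (restr x)) (inv_inj (xorfK _)))/=.
congr (_ <= _); apply: eq_bigr => y _.
by rewrite restr_xorf_emb /g xorfK.
Qed.

End Restriction.

(** * Random restriction to a section of disjoint blocks *)

Section RandomRestriction.
Variables (R : realFieldType) (I : finType) (m b : nat) (e : nat).
Variable idx : 'I_m -> 'I_b -> I.
Hypothesis idx_inj : injective (fun p => idx p.1 p.2).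

Definition section_of (s : {ffun 'I_m -> 'I_b}) (j : 'I_m) : I := idx j (s j).

Lemma section_of_inj s : injective (section_of s).
Proof. by move=> j k /(@idx_inj (_, _) (_, _)) []. Qed.

(* Union bound over the sets [H] of [e + 1] blocks in which the section meets [T]. *)
Lemma sum_large_trace (T : {set I}) (l : nat) : (0 < b)%N -> (#|T| <= l)%N -> (l <= b)%N ->
  \sum_(s : {ffun 'I_m -> 'I_b}) ((e < #|section_of s @^-1: T|)%N)%:R <=
  b%:R ^+ m * 2 ^+ m * (l%:R / b%:R) ^+ e.+1 :> R.
Proof.
move=> b0 Tl lb.
have bR : 0 < b%:R :> R by rewrite ltr0n.
(* The product of [P H j (s j)] over [j] indicates that the section meets [T] in all blocks of [H];
   as a product over blocks, it can be summed over sections block by block. *)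
pose P (H : {set 'I_m}) (j : 'I_m) (a : 'I_b) : R :=
  if j \in H then (idx j a \in T)%:R else 1.
apply: (@le_trans _ _ (\sum_(s : {ffun 'I_m -> 'I_b})
    \sum_(H : {set 'I_m} | #|H| == e.+1) \prod_j P H j (s j))).
  apply: ler_sum => s _.
  have P0 H j a : 0 <= P H j a by rewrite /P; case: ifP.
  have [es|_] := ltnP; last by apply: sumr_ge0 => H _; exact: prodr_ge0.
  have [H] : exists H : {set 'I_m}, (H \subset section_of s @^-1: T) && (#|H| == e.+1).
    have : (0 < #|[set H : {set 'I_m} | (H \subset section_of s @^-1: T) && (#|H| == e.+1)]|)%N.
      by rewrite cards_draws bin_gt0.
    by move=> /card_gt0P[H]; rewrite inE; exists H.
  move=> /andP[/fintype.subsetP HT He].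
  rewrite (bigD1 H)//= big1; first by rewrite lerDl sumr_ge0// => G _; exact: prodr_ge0.
  move=> j _; rewrite /P; case: ifP => // /HT; rewrite inE => ->.
  by [].
rewrite exchange_big/=.
apply: (@le_trans _ _ (\sum_(H : {set 'I_m} | #|H| == e.+1)
    b%:R ^+ m * (l%:R / b%:R) ^+ e.+1)).
  apply: ler_sum => H /eqP He; rewrite -bigA_distr_bigA/=.
  apply: (@le_trans _ _ (\prod_j (b%:R * (if j \in H then l%:R / b%:R else 1)))).
    apply: ler_prod => j _; apply/andP; split.
      by apply: sumr_ge0 => a _; rewrite /P; case: ifP.
    rewrite /P; case: (j \in H); last by rewrite sumr_const card_ord mulr1.
    rewrite mulrC divfK ?gt_eqF// -natr_sum ler_nat; apply: leq_trans Tl.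
    rewrite -big_mkcond/= sum1_card -(card_imset _ (f := idx j)); last first.
      by move=> a a' /(@idx_inj (_, _) (_, _)) [].
    by apply: subset_leq_card; apply/fintype.subsetP => _ /imsetP[a aT ->].
  by rewrite big_split/= prodr_const card_ord -big_mkcond/= prodr_const He.
(* The number of sets [H] is bounded crudely by [2^m]. *)
rewrite sumr_const -[leLHS]mulr_natr [leRHS]mulrAC.
apply: ler_wpM2l; first by rewrite mulr_ge0 ?exprn_ge0 ?divr_ge0.
rewrite -natrX ler_nat -[m in (2 ^ m)%N]card_ord -cardsT -card_powerset.
by apply: subset_leq_card; apply/fintype.subsetP => H _; rewrite powersetE finset.subsetT.
Qed.

(** By Parseval, each [fourier f T ^+ 2] is weighted by the number of sections on which the trace of
    [T] is large, and only sets [T] of size at most [l] occur. *)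
Lemma sum_high_part_random (f : {ffun I -> bool} -> R) (l : nat) :
  (0 < b)%N -> (l <= b)%N -> lowdeg l f ->
  \sum_(s : {ffun 'I_m -> 'I_b}) \sum_x high_part (section_of s) e f x ^+ 2 <=
  b%:R ^+ m * 2 ^+ m * (l%:R / b%:R) ^+ e.+1 * \sum_x f x ^+ 2.
Proof.
move=> b0 lb lf; under eq_bigr do rewrite sum_high_part big_mkcond.
rewrite -mulr_sumr exchange_big/= parseval mulrCA ler_wpM2l ?exprn_ge0//.
rewrite mulr_sumr; apply: ler_sum => T _.
have [Tl|/lf->] := leqP #|T| l; last first.
  by rewrite expr0n mulr0 big1// => s _; case: ifP.
apply: le_trans (ler_wpM2r (sqr_ge0 _) (sum_large_trace b0 Tl lb)).
rewrite mulr_suml; apply: ler_sum => s _.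
by case: ifP; rewrite ?mul1r ?mul0r.
Qed.

End RandomRestriction.

(** * Separation from a convex cone *)

Section ConeSeparation.
Local Open Scope classical_set_scope.
Variable R : realType.

Lemma dist2_continuous n (v w : 'rV[R]_n) (a : R) :
  continuous (fun u : 'rV[R]_n => \sum_j (v 0 j - a * u 0 j - w 0 j) ^+ 2 : R).
Proof.
move=> u; rewrite /continuous_at; elim: (index_enum _) => [|j s IH].
  rewrite big_nil (_ : (fun _ => _) = cst 0); first exact: (@cst_continuous _ R).
  by apply/funext => ?; rewrite big_nil.
rewrite big_cons (_ : (fun _ => _) = (fun u : 'rV[R]_n =>
  (v 0 j - a * u 0 j - w 0 j) ^+ 2 +
  \sum_(i <- s) (v 0 i - a * u 0 i - w 0 i) ^+ 2)); last first.
  by apply/funext => ?; rewrite big_cons.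
have F : Filter (nbhs u) by exact: nbhs_filter.
have hc (x : R) : (fun=> x) y @[y --> u] --> x by exact: (@cst_continuous _ R).
have hu : (fun y : 'rV[R]_n => y 0 j : R) y @[y --> u] --> u 0 j.
  exact: coord_continuous.
have h : (fun y : 'rV[R]_n => v 0 j - a * y 0 j - w 0 j : R) y @[y --> u] -->
    v 0 j - a * u 0 j - w 0 j.
  exact (cvgB (cvgB (hc (v 0 j)) (cvgM (hc a) hu)) (hc (w 0 j))).
exact (cvgD (cvgM h h) IH).
Qed.

(** [D = g - v] for the point [g] of the closure nearest to [v]. Optimality in the directions of the
    cone gives the first claim; moving both ways along the ray of [g] gives [D . g = 0], hence the
    second. *)
Lemma cone_projection n (C : set 'rV[R]_n) (v : 'rV[R]_n) : C 0 ->
  (forall u w, C u -> C w -> C (u + w)) ->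
  (forall (a : R) u, 0 <= a -> C u -> C (a *: u)) ->
  exists D : 'rV[R]_n,
  [/\ forall h, C h -> 0 <= \sum_j D 0 j * h 0 j,
      \sum_j D 0 j * v 0 j = - \sum_j D 0 j ^+ 2 &
      (D = 0 -> closure C v)].
Proof.
move=> C0 CD CZ.
pose q (u : 'rV[R]_n) : R := \sum_j (v 0 j - 1 * u 0 j - (0 : 'rV[R]_n) 0 j) ^+ 2.
have qE u : q u = \sum_j (v 0 j - u 0 j) ^+ 2.
  by apply: eq_bigr => j _; rewrite mul1r mxE subr0.
have cq : continuous q by exact: dist2_continuous.
(* Cutting by the ball around [v] through 0 gives compactness without losing the minimizer. *)
pose K := closure C `&` [set u | q u <= q 0].
have K0 : K !=set0 by exists 0; split; [exact: subset_closure|exact: lexx].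
have cK : compact K.
  pose box := [set u : 'rV[R]_n | forall j,
    `[v 0 j - (1 + q 0), v 0 j + (1 + q 0)] (u ord0 j)].
  have cbox : compact box.
    apply: (@rV_compact _ _ (fun j => `[v 0 j - (1 + q 0), v 0 j + (1 + q 0)]%classic)).
    by move=> j; exact: segment_compact.
  apply: (subclosed_compact _ cbox).
    apply: closedI; first exact: closed_closure.
    by apply: (@closed_comp _ _ q [set x | x <= q 0]) => [x _|]; [exact: cq|exact: closed_le].
  move=> u [_ /= qu] j /=.
  have h : (v 0 j - u 0 j) ^+ 2 <= q 0.
    apply: le_trans qu; rewrite qE (bigD1 j)//= lerDl sumr_ge0// => i _.
    exact: sqr_ge0.
  have q0 : 0 <= q 0 by exact: le_trans (sqr_ge0 _) h.
  (* [1 + q 0] bounds the square root of [q 0]. *)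
  have : `|v 0 j - u 0 j| <= 1 + q 0.
    rewrite -(@ler_pXn2r _ 2)// ?nnegrE ?addr_ge0// real_normK ?num_real//.
    by apply: le_trans h _; nra.
  by rewrite in_itv/= ler_norml; lra.
have [g gK gmin] := EVT_min_rV K0 cK (continuous_subspaceT cq).
move: gK; rewrite inE => -[gC /= qg0].
have gminC u : C u -> q g <= q u.
  move=> Cu; have [qu|/ltW qu] := leP (q u) (q 0); last exact: le_trans qg0 _.
  by apply: gmin; rewrite inE; split => //; exact: subset_closure.
(* [g] need not lie in [C], so minimality over the image of [C] is first passed to the closure by
   continuity. *)
have ext (a : R) (w : 'rV[R]_n) : (forall u, C u -> C (a *: u + w)) ->
    q g <= q (a *: g + w).
  move=> h; pose p (u : 'rV[R]_n) : R := \sum_j (v 0 j - a * u 0 j - w 0 j) ^+ 2.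
  have pE u : p u = q (a *: u + w).
    by rewrite qE; apply: eq_bigr => j _; rewrite !mxE; ring.
  have cl : closed [set u | q g <= p u].
    apply: (@closed_comp _ _ p [set x | q g <= x]) => [x _|]; last exact: closed_ge.
    exact: dist2_continuous.
  rewrite -pE; suff : closure C `<=` [set u | q g <= p u] by exact.
  rewrite (closure_id [set u | q g <= p u]).1//; apply: closure_subset => u Cu /=.
  by rewrite pE; apply: gminC; exact: h.
pose D := g - v.
have qgE : q g = \sum_j D 0 j ^+ 2.
  by rewrite qE; apply: eq_bigr => j _; rewrite !mxE; ring.
(* A quadratic vanishing at 0 and nonnegative on [[0, 1]] has nonnegative slope at 0; a negative
   slope is refuted at [t = - b / (c - b)]. *)
have small (b c : R) : 0 <= c ->
    (forall t, 0 <= t <= 1 -> 0 <= t * b *+ 2 + t ^+ 2 * c) -> 0 <= b.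
  move=> c0 h; rewrite leNgt; apply/negP => b0.
  have bc : 0 < - b + c by lra.
  have t0 : 0 < - b / (- b + c) by rewrite divr_gt0// oppr_gt0.
  have t1 : - b / (- b + c) <= 1 by rewrite ler_pdivrMr//; lra.
  have := h _ (introT andP (conj (ltW t0) t1)); move: t0 t1; set t := _ / _.
  have tE : t * (- b + c) = - b by rewrite /t divfK// gt_eqF.
  by move=> t0 t1; nra.
have perturb (h : 'rV[R]_n) (a t : R) (w : 'rV[R]_n) :
    a *: g + w = g + t *: h -> (forall u, C u -> C (a *: u + w)) ->
    0 <= t * (\sum_j D 0 j * h 0 j) *+ 2 + t ^+ 2 * \sum_j h 0 j ^+ 2.
  move=> e /ext; rewrite e qgE qE -subr_ge0; congr (_ <= _).
  rewrite !mulr_sumr -sumrMnl -big_split/= -sumrB.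
  by apply: eq_bigr => j _; rewrite !mxE; ring.
have sqr_ge (h : 'rV[R]_n) : 0 <= \sum_j h 0 j ^+ 2.
  by apply: sumr_ge0 => j _; exact: sqr_ge0.
exists D; split.
- move=> h Ch; apply: (small _ _ (sqr_ge h)) => t /andP[t0 _].
  apply: (perturb h 1 t (t *: h)) => [|u Cu]; first by rewrite scale1r.
  by rewrite scale1r; apply: CD => //; exact: CZ.
- have scale t : 0 <= 1 + t ->
      0 <= t * (\sum_j D 0 j * g 0 j) *+ 2 + t ^+ 2 * \sum_j g 0 j ^+ 2.
    move=> t1; apply: (perturb g (1 + t) t 0) => [|u Cu].
      by rewrite addr0 scalerDl scale1r.
    by rewrite addr0; exact: CZ.
  have Dg : \sum_j D 0 j * g 0 j = 0.
    apply: le_anti; apply/andP; split.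
      rewrite -oppr_ge0; apply: (small _ _ (sqr_ge g)) => t /andP[t0 t1].
      have := scale (- t); rewrite sqrrN mulrN mulNr; apply; lra.
    by apply: (small _ _ (sqr_ge g)) => t /andP[t0 t1]; apply: scale; lra.
  transitivity (\sum_j (D 0 j * g 0 j - D 0 j ^+ 2)).
    by apply: eq_bigr => j _; rewrite !mxE; ring.
  by rewrite sumrB Dg add0r.
- move=> D0; have -> : v = g by apply/eqP; rewrite eq_sym -subr_eq0 -/D D0.
  exact: gC.
Qed.

(** The first alternative is only approximate because the cone is not assumed closed. It holds when
    the vector [D] of the projection is 0; otherwise [D . v = - |D|^2] is negative. *)
Lemma cone_separation (T : finType) (C : (T -> R) -> Prop) (v : T -> R) :
  C (fun=> 0) ->
  (forall f g, C f -> C g -> C (fun x => f x + g x)) ->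
  (forall (a : R) f, 0 <= a -> C f -> C (fun x => a * f x)) ->
  (forall f g, f =1 g -> C f -> C g) ->
  (forall e, 0 < e -> exists2 h, C h & \sum_x (v x - h x) ^+ 2 < e) \/
  exists D : T -> R, (forall h, C h -> 0 <= \sum_x D x * h x) /\
    \sum_x D x * v x < 0.
Proof.
move=> C0 CD CZ Ceq.
pose fn (u : 'rV[R]_#|T|) (x : T) : R := u 0 (enum_rank x).
pose rw (f : T -> R) : 'rV[R]_#|T| := \row_j f (enum_val j).
have fnK f : fn (rw f) =1 f by move=> x; rewrite /fn mxE enum_rankK.
have sumE (F : 'I_#|T| -> R) : \sum_j F j = \sum_x F (enum_rank x).
  by rewrite (reindex _ (onW_bij _ (@enum_rank_bij T))).
have [|||D [DC Dv D0]] := @cone_projection _ [set u | C (fn u)] (rw v).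
- by apply: Ceq C0 => x; rewrite /fn mxE.
- by move=> u w Cu Cw; apply: Ceq (CD _ _ Cu Cw) => x; rewrite /fn mxE.
- by move=> a u a0 Cu; apply: Ceq (CZ _ _ a0 Cu) => x; rewrite /fn mxE.
have [/D0 vC|Dn0] := eqVneq D 0; [left|right].
  move=> e e0.
  pose q (u : 'rV[R]_#|T|) : R := \sum_j (rw v 0 j - 1 * u 0 j - (0 : 'rV[R]_#|T|) 0 j) ^+ 2.
  have qE u : q u = \sum_x (v x - fn u x) ^+ 2.
    rewrite /q sumE; apply: eq_bigr => x _.
    by rewrite /fn !mxE enum_rankK mul1r subr0.
  have : nbhs (rw v) [set u | q u < e].
    apply: open_nbhs_nbhs; split.
      apply: (@open_comp _ _ q [set x | x < e]) => [x _|]; last exact: open_lt.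
      exact: dist2_continuous.
    by rewrite /= qE big1// => x _; rewrite fnK subrr expr0n.
  by move=> /vC[u [Cu qu]]; exists (fn u) => //; rewrite -qE.
exists (fn D); split.
  move=> h Ch; have := DC (rw h) (Ceq _ _ (fun x => esym (fnK h x)) Ch).
  rewrite sumE; congr (_ <= _); apply: eq_bigr => x _.
  by rewrite mxE enum_rankK.
have -> : \sum_x fn D x * v x = - \sum_j D 0 j ^+ 2.
  by rewrite -Dv sumE; apply: eq_bigr => x _; rewrite mxE enum_rankK.
rewrite oppr_lt0 lt_neqAle sumr_ge0 ?andbT; last by move=> j _; exact: sqr_ge0.
apply: contra Dn0; rewrite eq_sym psumr_eq0 => [/allP h|j _]; last exact: sqr_ge0.
apply/eqP/rowP => j; have := h j; rewrite mem_index_enum => /(_ isT).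
by rewrite sqrf_eq0 mxE => /eqP.
Qed.

End ConeSeparation.

(** * Sums of squares and pseudodensities *)

Section SumsOfSquares.
Variable R : realType.

(** Expanding each [(-1)^x_i = 1 - 2 x_i] turns [chi T] into the sum over [V] in [T] of [(- 2)^|V|]
    times the monomial of [V]. *)
Lemma lowdeg_mlpoly (n e : nat) (g : cube n -> R) : lowdeg e g ->
  exists2 p : mlpoly R n, (mldeg p <= e)%N & forall x, mleval p x = g x.
Proof.
move=> lg.
pose p : mlpoly R n := [ffun V : {set 'I_n} =>
  \sum_(T : {set 'I_n} | V \subset T) fourier g T * (- 2) ^+ #|V|].
exists p.
  apply/bigmax_leqP => V; rewrite ffunE; apply: contraR; rewrite -ltnNge => eV.
  apply/eqP; rewrite big1// => T /subset_leq_card VT.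
  by rewrite lg ?mul0r// (leq_trans eV).
move=> x; rewrite [RHS]fourier_inv /mleval.
under eq_bigr do rewrite ffunE big_mkcond mulr_suml.
rewrite exchange_big/=; apply: eq_bigr => T _.
have -> : chi R T x = \prod_i ((if i \in T then - 2 * (x i)%:R else 0) + 1).
  rewrite chiE; apply: eq_bigr => i _; case: ifP => _; last by rewrite add0r.
  by case: (x i); rewrite ?expr1 ?expr0/=; lra.
rewrite bigA_distr/= mulr_sumr; apply: eq_bigr => V _.
have [VT|/subsetPn[i iV iT]] := boolP (V \subset T); last first.
  by rewrite mul0r [in RHS](bigD1 i)//= iV (negPf iT) mul0r mulr0.
rewrite -mulrA; congr (_ * _); rewrite -big_mkcond/= -prodr_const -big_split/=.
by apply: eq_bigr => i /(fintype.subsetP VT)->.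
Qed.

Section Cone.
Variables (J : finType) (e : nat).
Local Notation fn := ({ffun J -> bool} -> R).

Inductive sos_cone : fn -> Prop :=
| sos_cone0 : sos_cone (fun=> 0)
| sos_cone_cons f g of sos_cone f & lowdeg e g : sos_cone (fun y => g y ^+ 2 + f y).

Lemma eq_sos_cone (f g : fn) : f =1 g -> sos_cone f -> sos_cone g.
Proof. by move=> /funext->. Qed.

Lemma sos_coneD f g : sos_cone f -> sos_cone g -> sos_cone (fun y => f y + g y).
Proof.
move=> + cg; elim=> [|f' h _ IH lh]; first by apply: eq_sos_cone cg => y; rewrite add0r.
by apply: eq_sos_cone (sos_cone_cons IH lh) => y; rewrite addrA.
Qed.

Lemma sos_coneZ (a : R) f : 0 <= a -> sos_cone f -> sos_cone (fun y => a * f y).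
Proof.
move=> a0; elim=> [|f' h _ IH lh]; first by apply: eq_sos_cone sos_cone0 => y; rewrite mulr0.
apply: eq_sos_cone (sos_cone_cons IH (lowdegZ (Num.sqrt a) lh)) => y.
by rewrite exprMn sqr_sqrtr// mulrDr.
Qed.

Lemma sos_cone_sqr g : lowdeg e g -> sos_cone (fun y => g y ^+ 2).
Proof.
by move=> lg; apply: eq_sos_cone (sos_cone_cons sos_cone0 lg) => y; rewrite addr0.
Qed.

Lemma sos_cone_cst (a : R) : 0 <= a -> sos_cone (fun=> a).
Proof.
move=> a0; apply: eq_sos_cone (sos_cone_sqr (@lowdeg_cst _ _ e (Num.sqrt a))) => y.
exact: sqr_sqrtr.
Qed.

Lemma sos_cone_sum (K : Type) (s : seq K) (F : K -> fn) :
  (forall k, sos_cone (F k)) -> sos_cone (fun y => \sum_(k <- s) F k y).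
Proof.
move=> h; elim: s => [|k s IH].
  by apply: eq_sos_cone sos_cone0 => y; rewrite big_nil.
by apply: eq_sos_cone (sos_coneD (h k) IH) => y; rewrite big_cons.
Qed.

Lemma sos_cone_lowdeg f : sos_cone f -> lowdeg (e + e) f.
Proof.
elim=> [|f' g _ IH lg]; first exact: lowdeg_cst.
by apply: eq_lowdeg (lowdegD (lowdegM lg lg) IH) _ => y; rewrite expr2.
Qed.

(* A set of size at most [2 e] splits into two sets [A] and [B] of size at most [e],
   and then [(chi A -/+ chi B) ^ 2 = 2 -/+ 2 chi U]. *)
Lemma sos_cone_chi (U : {set J}) (a : R) : (#|U| <= e + e)%N ->
  sos_cone (fun y => `|a| - a * chi R U y).
Proof.
move=> Ue; have [A [AU Ae Be]] : exists A : {set J},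
    [/\ A \subset U, (#|A| <= e)%N & (#|U :\: A| <= e)%N].
  have [Ul|/ltnW eU] := leqP #|U| e.
    by exists U; split; rewrite // finset.setDv cards0.
  have : (0 < #|[set A : {set J} | (A \subset U) && (#|A| == e)]%SET|)%N.
    by rewrite cards_draws bin_gt0.
  move=> /card_gt0P[A]; rewrite inE => /andP[AU /eqP Ae].
  exists A; split; rewrite ?Ae// cardsD (finset.setIidPr AU) Ae.
  by rewrite leq_subLR.
have chiU y : chi R U y = chi R A y * chi R (U :\: A) y.
  rewrite chiM; congr (chi R _ y); apply/finset.setP => j; rewrite !inE.
  by have /fintype.subsetP/(_ j) := AU; case: (j \in A) => //= [->|]; case: (j \in U).
have := @sos_coneZ (`|a| / 2) _ _ (sos_cone_sqr (lowdegD (lowdeg_chi R Ae)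
  (lowdegZ (- Num.sg a) (lowdeg_chi R Be)))).
move=> /(_ _)/wrap[]; first by rewrite divr_ge0.
apply: eq_sos_cone => y; rewrite chiU.
have [->|a0] := eqVneq a 0; first by rewrite normr0 !mul0r subrr.
have s2 : Num.sg a ^+ 2 = 1 by rewrite sqr_sg a0.
rewrite [X in _ - X * _]numEsg.
have := chi_sqr R A y; have := chi_sqr R (U :\: A) y; move: s2.
move: (chi R A y) (chi R _ y) (Num.sg a) `|a| => u v s b hs hv hu.
have -> : (u + - s * v) ^+ 2 = u ^+ 2 - 2 * (s * (u * v)) + s ^+ 2 * v ^+ 2 by ring.
by rewrite hs hv hu; field.
Qed.

(** Positive constants are interior to the cone in degree [2 e]: the error [w = h - f] is removed
    character by character, each at the cost [|fourier w U|] by [sos_cone_chi], and Parseval bounds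
    the total by [a]. This replaces a proof that the cone is closed. *)
Lemma sos_cone_near (f h : fn) (a : R) : 0 < a -> lowdeg (e + e) f -> sos_cone h ->
  \sum_y (f y - h y) ^+ 2 < 2 ^+ #|J| * (a / 2 ^+ #|J|) ^+ 2 ->
  sos_cone (fun y => a + f y).
Proof.
move=> a0 lf ch small.
pose w y := h y + -1 * f y.
have lw : lowdeg (e + e) w by apply: lowdegD (sos_cone_lowdeg ch) (lowdegZ _ lf).
have p0 : 0 < 2 ^+ #|J| :> R by rewrite exprn_gt0.
have wU U : `|fourier w U| <= a / 2 ^+ #|J|.
  rewrite -(@ler_pXn2r _ 2)// ?nnegrE ?divr_ge0 ?(ltW a0)// real_normK ?num_real//.
  apply: ltW; rewrite -(ltr_pM2l p0); apply: le_lt_trans small.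
  rewrite (eq_bigr (fun y => w y ^+ 2)) => [|y _]; last by rewrite /w; ring.
  rewrite parseval ler_pM2l// (bigD1 U)//= lerDl sumr_ge0// => V _.
  exact: sqr_ge0.
have wsum : \sum_U `|fourier w U| <= a.
  apply: le_trans (ler_sum _ (fun U _ => wU U)) _.
  have -> : \sum_(U : {set J}) a / 2 ^+ #|J| = a / 2 ^+ #|J| *+ (2 ^ #|J|).
    rewrite sumr_const; congr (_ *+ _).
    by rewrite -[in RHS]cardsT -card_powerset powersetT [RHS]cardsT.
  by rewrite -[leLHS]mulr_natr natrX divfK// gt_eqF.
have c1 : sos_cone (fun y => \sum_U (`|fourier w U| - fourier w U * chi R U y)).
  apply: sos_cone_sum => U; have [Ue|/lw->] := leqP #|U| (e + e).
    exact: sos_cone_chi.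
  by apply: eq_sos_cone sos_cone0 => y; rewrite normr0 mul0r subrr.
have c2 := @sos_cone_cst (a - \sum_U `|fourier w U|).
apply: eq_sos_cone (sos_coneD ch (sos_coneD (c2 _) c1)); last by rewrite subr_ge0.
by move=> y; rewrite sumrB -fourier_inv /w; ring.
Qed.

Lemma sos_cone_separation (f : fn) (a : R) : 0 < a -> lowdeg (e + e) f ->
  ~ sos_cone (fun y => a + f y) ->
  exists D : fn, (forall g, lowdeg e g -> 0 <= \sum_y D y * g y ^+ 2) /\
    \sum_y D y * f y < 0.
Proof.
move=> a0 lf nf.
have [near|[D [DC Df]]] :=
  @cone_separation _ _ sos_cone f sos_cone0 sos_coneD sos_coneZ eq_sos_cone.
  have [|h ch hh] := near (2 ^+ #|J| * (a / 2 ^+ #|J|) ^+ 2).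
    by rewrite mulr_gt0 ?exprn_gt0 ?divr_gt0 ?exprn_gt0.
  by have := sos_cone_near a0 lf ch hh.
by exists D; split=> // g lg; apply: DC; exact: sos_cone_sqr.
Qed.

End Cone.

Lemma sos_cone_is_sos (n d : nat) (f : cube n -> R) : sos_cone d./2 f -> is_sos d f.
Proof.
elim=> [|f' g _ [gs [gd gE]] lg].
  by exists [::]; split=> // x; rewrite big_nil.
have [p pd pE] := lowdeg_mlpoly lg.
exists (p :: gs); split=> [q|x]; last by rewrite big_cons pE gE.
rewrite inE => /orP[/eqP->|/gd//].
by rewrite (leq_trans (leq_mul (leqnn 2) pd))// mul2n -geq_half_double.
Qed.

Lemma lowdeg_value (k : nat) (Pi : {set predicate k}) (n : nat) (I : instance Pi n) :
  lowdeg k (value R I).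
Proof.
apply: lowdegZ; case: I => cs _ /= /allP csP.
(* Constraints outside the list are replaced by 0, since only those in the list are known to have
   distinct indices. *)
pose F (C : constraint k n) (x : cube n) : R :=
  if C \in cs then (satisfied C x)%:R else 0.
apply: (@eq_lowdeg _ _ _ (fun x => \sum_(C <- cs) F C x)); last first.
  by move=> x; rewrite !big_seq; apply: eq_bigr => C Ccs; rewrite /F Ccs.
apply: lowdeg_sum => C _.
have [Ccs|/negPf Ccs] := boolP (C \in cs); last first.
  by apply: eq_lowdeg (lowdeg_cst 0) _ => x; rewrite /F Ccs.
have /andP[_ /injectiveP inj] := csP _ Ccs.
have := lowdeg_restr inj (fun y => (C.1 y)%:R : R); rewrite card_ord => l.
by apply: eq_lowdeg l _ => x; rewrite /F Ccs.
Qed.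

(** An sos value above [c] leaves a margin [a > 0] with [c + a - I] not a sum of squares, as
    [sos_cone_separation] requires. *)
Lemma pseudodensity (d k : nat) (Pi : {set predicate k}) (n : nat) (I : instance Pi n)
    (c : R) :
  (2 * uphalf k <= d)%N -> ~ (sos_value R d I <= c%:E)%E ->
  exists D : cube n -> R, (forall g, lowdeg d./2 g -> 0 <= \sum_y D y * g y ^+ 2) /\
    \sum_y D y * (c - value R I y) < 0.
Proof.
move=> hd nle.
have [a a0 nsos] : exists2 a : R, 0 < a & ~ is_sos d (fun x => (c + a) - value R I x).
  apply: contrapT => h; apply: nle; apply/lee_addgt0Pr => a a0.
  apply: ereal_inf_lbound; exists (c + a); last by rewrite EFinD.
  by apply: contrapT => h'; apply: h; exists a.
apply: (sos_cone_separation a0).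
  apply: lowdegD (lowdeg_cst _) _.
  apply: (@eq_lowdeg _ _ _ (fun x => -1 * value R I x)) => [|x]; last by rewrite mulN1r.
  apply: lowdegZ; apply: lowdegW (lowdeg_value I).
  (* The assumption on [d] enters here, as [k <= 2 floor (d / 2)]. *)
  by rewrite addnn -leq_uphalf_double geq_half_double -mul2n.
move=> cs; apply: nsos; apply: sos_cone_is_sos.
by apply: eq_sos_cone cs => x; ring.
Qed.

End SumsOfSquares.

(** * Duality for SDP relaxations *)

Section Duality.
Variables (R : realType) (k : nat) (Pi : {set predicate k}) (n r : nat).
Variable S : sdp_relaxation R Pi n r.

Lemma frobeniusDr (A B C : 'M[R]_r) : frobenius A (B + C) = frobenius A B + frobenius A C.
Proof. by rewrite /frobenius mulmxDr mxtraceD. Qed.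

Lemma frobeniusZr (A B : 'M[R]_r) (a : R) : frobenius A (a *: B) = a * frobenius A B.
Proof. by rewrite /frobenius -scalemxAr mxtraceZ. Qed.

(* Only approximate: the cone of the functionals [x |-> tr (L x~) + a] need not be closed. *)
Lemma sdp_duality (I : instance Pi n) (c d : R) : 0 < d ->
  (sdp_value S I <= c%:E)%E ->
  exists L a, [/\ psd L, 0 <= a &
    forall x, `|c - value R I x - (\tr (L *m sdp_point S x) + a)| <= d].
Proof.
move=> d0 Sc.
have feas y : sdp_feasible S y -> frobenius (sdp_instance S I) y <= c.
  move=> fy; rewrite -lee_fin; apply: le_trans Sc.
  by apply: ereal_sup_ubound; exists y.
pose C (f : cube n -> R) := exists L a,
  [/\ psd L, 0 <= a & forall x, f x = \tr (L *m sdp_point S x) + a].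
have C0 : C (fun=> 0).
  by exists 0, 0; split=> [||x] //; [exact: psd0|rewrite mul0mx mxtrace0 addr0].
have CD f g : C f -> C g -> C (fun x => f x + g x).
  move=> [L [a [pL a0 fE]]] [M [b [pM b0 gE]]].
  exists (L + M), (a + b); split; [exact: psdD|exact: addr_ge0|move=> x].
  by rewrite fE gE mulmxDl mxtraceD; ring.
have CZ (t : R) f : 0 <= t -> C f -> C (fun x => t * f x).
  move=> t0 [L [a [pL a0 fE]]]; exists (t *: L), (t * a).
  split; [exact: psdZ|exact: mulr_ge0|move=> x].
  by rewrite fE -scalemxAl mxtraceZ mulrDr.
have Ceq f g : f =1 g -> C f -> C g by move=> /funext->.
have [near|[D [DC Df]]] := cone_separation (fun x => c - value R I x) C0 CD CZ Ceq.
  have [|h [L [a [pL a0 hE]]] hd] := near (d ^+ 2); first by rewrite exprn_gt0.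
  exists L, a; split=> // x; rewrite -hE -(@ler_pXn2r _ 2)// ?nnegrE ?(ltW d0)//.
  rewrite real_normK ?num_real//; apply: le_trans (ltW hd).
  by rewrite (bigD1 x)//= lerDl sumr_ge0// => y _; exact: sqr_ge0.
(* [Y] is psd because [D] is nonnegative on the functionals of all psd [L]; if [s > 0], then [Y / s]
   is feasible with value above [c]. *)
exfalso; pose Y := \sum_x D x *: sdp_point S x; pose s := \sum_x D x.
have s0 : 0 <= s.
  have := DC (fun=> 1); rewrite -mulr_suml mulr1; apply.
  by exists 0, 1; split=> // [|x]; [exact: psd0|rewrite mul0mx mxtrace0 add0r].
have sym x : (sdp_point S x)^T = sdp_point S x.
  by have [_ []] := sdp_point_feasible S x.
have pY : psd Y.
  split; first by rewrite /Y linear_sum/=; apply: eq_bigr => x _; rewrite linearZ/= sym.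
  move=> v; have -> : (v^T *m Y *m v) 0 0 = \tr (v *m v^T *m Y).
    by rewrite -(mulmxA v) mxtrace_mulC [RHS]big_ord1.
  rewrite /Y mulmx_sumr raddf_sum/=.
  rewrite (eq_bigr (fun x => D x * \tr (v *m v^T *m sdp_point S x))); last first.
    by move=> x _; rewrite -scalemxAr mxtraceZ.
  apply: DC; exists (v *m v^T), 0; split=> // [|x]; last by rewrite addr0.
  exact: psd_mul_tr.
have AY : sdp_map S Y = s *: sdp_rhs S.
  rewrite /Y linear_sum/= scaler_suml; apply: eq_bigr => x _.
  by rewrite linearZ/=; have [-> _] := sdp_point_feasible S x.
have DE : \sum_x D x * (c - value R I x) = s * c - frobenius (sdp_instance S I) Y.
  rewrite /Y /s mulr_suml; under eq_bigr do rewrite mulrBr.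
  rewrite sumrB; congr (_ - _).
  rewrite /frobenius mulmx_sumr raddf_sum/=; apply: eq_bigr => x _.
  by rewrite (sdp_valueE S) -frobeniusZr.
move: Df; rewrite DE subr_lt0 => Df.
move: s0; rewrite le_eqVlt => /orP[/eqP s0|s0].
  (* For [s = 0], [Y] is a recession direction of positive value: a large multiple added to a
     feasible point exceeds [c]. *)
  pose x0 : cube n := [ffun=> false].
  have frobY : 0 < frobenius (sdp_instance S I) Y by move: Df; rewrite -s0 mul0r.
  pose f0 := frobenius (sdp_instance S I) (sdp_point S x0).
  pose t := (`|c| + `|f0| + 1) / frobenius (sdp_instance S I) Y.
  have t0 : 0 <= t by rewrite divr_ge0 ?ltW// ?addr_ge0//.
  have := feas (sdp_point S x0 + t *: Y).
  rewrite frobeniusDr frobeniusZr -/f0 /t divfK ?gt_eqF// => /(_ _)/wrap[].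
    have [A0 p0] := sdp_point_feasible S x0; split.
      by rewrite linearD/= linearZ/= A0 AY -s0 scale0r scaler0 addr0.
    by apply: psdD => //; exact: psdZ.
  have := ler_norm c; have := ler_norm (- f0); rewrite normrN; lra.
have := feas (s^-1 *: Y); rewrite frobeniusZr => /(_ _)/wrap[].
  split; last by apply: psdZ => //; rewrite invr_ge0 ltW.
  by rewrite linearZ/= AY scalerA mulVf ?gt_eqF// scale1r.
by rewrite ler_pdivrMl// leNgt Df.
Qed.

End Duality.

(** * The moment argument *)

Section TraceMoments.
Variables (R : realType) (r : nat).
Implicit Types (A B P Q Y : 'M[R]_r).

Lemma psd_trmx A : psd A -> A^T = A.
Proof. by case. Qed.

Lemma trmx_exp A q : A^T = A -> (A ^+ q)^T = A ^+ q.
Proof.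
move=> sA; elim: q => [|q IH]; first by rewrite expr0 trmx1.
by rewrite {1}exprS -mulmxE trmx_mul IH sA mulmxE -exprSr.
Qed.

Lemma psd_exp A q : psd A -> psd (A ^+ q).
Proof.
move=> pA; have sA := trmx_exp q./2 (psd_trmx pA).
have pB : psd (A ^+ odd q) by case: (odd q); [rewrite expr1|exact: psd1].
have := psd_conj (A ^+ q./2) pB.
by rewrite sA !mulmxE -!exprD addnAC addnn addnC odd_double_half.
Qed.

Lemma psd_tr_le (c : R) A B : psd (c%:M - A) -> psd B -> \tr (A *m B) <= c * \tr B.
Proof.
move=> pA pB; have := psd_trM_ge0 pA pB.
by rewrite mulmxBl linearB/= mul_scalar_mx mxtraceZ subr_ge0.
Qed.

(** The sum of [tr (Q A Y B^T)] is a positive semidefinite symmetric form in the matrix-valued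
    functions [A] and [B]. *)
Lemma trace_CauchySchwarz (X : finType) (Q Y A B : X -> 'M[R]_r) :
  (forall x, psd (Q x)) -> (forall x, psd (Y x)) ->
  (\sum_x \tr (Q x *m (A x *m Y x *m (B x)^T))) ^+ 2 <=
  (\sum_x \tr (Q x *m (A x *m Y x *m (A x)^T))) *
  (\sum_x \tr (Q x *m (B x *m Y x *m (B x)^T))).
Proof.
move=> pQ pY; apply: discriminant_le => [|t].
  by apply: sumr_ge0 => x _; apply: psd_trM_ge0 => //; exact: psd_conj.
have : 0 <= \sum_x \tr (Q x *m ((A x + t *: B x) *m Y x *m (A x + t *: B x)^T)).
  by apply: sumr_ge0 => x _; apply: psd_trM_ge0 => //; exact: psd_conj.
congr (_ <= _); rewrite !mulr_sumr -sumrMnl -!big_split/=; apply: eq_bigr => x _.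
have -> : (A x + t *: B x)^T = (A x)^T + t *: (B x)^T by rewrite linearD/= linearZ.
have sym : \tr (Q x *m (B x *m Y x *m (A x)^T)) = \tr (Q x *m (A x *m Y x *m (B x)^T)).
  rewrite -mxtrace_tr !trmx_mul trmxK (psd_trmx (pQ x)) (psd_trmx (pY x)).
  by rewrite mxtrace_mulC !mulmxA.
rewrite !(mulmxDl, mulmxDr) -!(scalemxAl, scalemxAr).
rewrite !mxtraceD !mxtraceZ sym.
by ring.
Qed.

(** Cauchy-Schwarz with [A = Y^(q./2)], [B = A Y] and [Y^(odd q)] in the middle, which covers both
    parities. *)
Lemma trace_moment_logconvex (X : finType) (Q Y : X -> 'M[R]_r) (q : nat) :
  (forall x, psd (Q x)) -> (forall x, psd (Y x)) ->
  (\sum_x \tr (Q x *m Y x ^+ q.+1)) ^+ 2 <=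
  (\sum_x \tr (Q x *m Y x ^+ q)) * (\sum_x \tr (Q x *m Y x ^+ q.+2)).
Proof.
move=> pQ pY.
have /= := @trace_CauchySchwarz _ Q (fun x => Y x ^+ odd q) (fun x => Y x ^+ q./2)
  (fun x => Y x ^+ q./2.+1) pQ (fun x => psd_exp _ (pY x)).
have e i j : \sum_x \tr (Q x *m (Y x ^+ i *m Y x ^+ odd q *m (Y x ^+ j)^T)) =
    \sum_x \tr (Q x *m Y x ^+ (i + odd q + j)).
  apply: eq_bigr => x _.
  by rewrite trmx_exp ?(psd_trmx (pY x))// !mulmxE -!exprD.
rewrite !e.
have h : (q./2 + odd q + q./2 = q)%N by rewrite addnAC addnn addnC odd_double_half.
rewrite !addnS !addSn h.
by [].
Qed.

End TraceMoments.

Section LogConvexSequences.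
Variables (R : realFieldType) (u : nat -> R).
Hypotheses (u_ge0 : forall q, 0 <= u q)
  (u_lc : forall q, u q.+1 ^+ 2 <= u q * u q.+2).

(** Ratios of consecutive terms do not decrease, so a lower bound on the first one persists. *)
Lemma logconvex_lower (b : R) : 0 < b -> 0 < u 0 -> b * u 0 <= u 1 ->
  forall q, b ^+ q * u 0 <= u q.
Proof.
move=> b0 u0 u1 q.
suff /(_ q)[] : forall q, [/\ b ^+ q * u 0 <= u q, 0 < u q & b * u q <= u q.+1] by [].
elim=> [|p [h1 h2 h3]]; first by rewrite expr0 mul1r.
have up : 0 < u p.+1 by apply: lt_le_trans h3; rewrite mulr_gt0.
split=> //.
  by apply: le_trans h3; rewrite exprS -mulrA ler_pM2l.
rewrite -(ler_pM2l h2); apply: le_trans (u_lc p).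
by rewrite mulrA (mulrC (u p)) expr2 ler_pM2r.
Qed.

(** The same monotonicity read backwards: a bound on the last ratio bounds all earlier ones. *)
Lemma logconvex_upper (c : R) q : 0 <= c -> u q.+1 <= c * u q ->
  u q.+1 <= c ^+ q.+1 * u 0.
Proof.
move=> c0; elim: q => [|q IH] h; first by rewrite expr1.
have hq : u q.+1 <= c * u q.
  have := u_ge0 q.+1; rewrite le_eqVlt => /orP[/eqP<-|u1].
    exact: mulr_ge0.
  rewrite -(ler_pM2r u1) -expr2; apply: le_trans (u_lc q) _.
  by rewrite [leRHS]mulrAC [leRHS]mulrC ler_wpM2l.
by apply: le_trans h _; rewrite exprS -mulrA ler_wpM2l// IH.
Qed.

End LogConvexSequences.

(** * Squares tested against a restricted pseudodensity *)

Section PseudoPositivity.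
Variables (R : realType) (I J : finType) (s : J -> I).
Hypothesis s_inj : injective s.
Variables (e : nat) (D : {ffun J -> bool} -> R) (B : R).
Hypothesis D_sqr_ge0 : forall g, lowdeg e g -> 0 <= \sum_y D y * g y ^+ 2.
Hypotheses (B0 : 0 < B) (D_le : forall y, `|D y| <= B).
Local Notation boolcube := {ffun I -> bool}.

Lemma high_part_sum (K : finType) (a : K -> R) (f : K -> boolcube -> R) x :
  high_part s e (fun x => \sum_k a k * f k x) x = \sum_k a k * high_part s e (f k) x.
Proof.
rewrite /high_part; under [RHS]eq_bigr do rewrite mulr_sumr.
rewrite exchange_big/=; apply: eq_bigr => T _.
under [RHS]eq_bigr do rewrite mulrA.
rewrite -mulr_suml; congr (_ * _); rewrite /fourier.
under [RHS]eq_bigr do rewrite mulrA.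
rewrite -mulr_suml; congr (_ / _).
under [RHS]eq_bigr do rewrite mulr_sumr.
rewrite exchange_big/=; apply: eq_bigr => y _; rewrite mulr_suml.
by apply: eq_bigr => k _; rewrite mulrA.
Qed.

(** The low part has a nonnegative test. What remains, [D (2 f h - h^2)] with [h] the high part, is
    controlled by [|D| <= B] and AM-GM with free weight [t]. *)
Lemma sqr_test_ge (t : R) (f : boolcube -> R) : 0 < t ->
  - B * (t * \sum_x f x ^+ 2 + (t^-1 + 1) * \sum_x high_part s e f x ^+ 2) <=
  \sum_x D (restr s x) * f x ^+ 2.
Proof.
move=> t0; have low := low_part_ge0 s_inj D_sqr_ge0 f.
have : \sum_x (D (restr s x) * low_part s e f x ^+ 2 -
    B * (t * f x ^+ 2 + (t^-1 + 1) * high_part s e f x ^+ 2)) <=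
    \sum_x D (restr s x) * f x ^+ 2.
  apply: ler_sum => x _.
  have -> : low_part s e f x = f x - high_part s e f x.
    by rewrite (low_highE s e f x) addrK.
  move: (f x) (high_part s e f x) (D_le (restr s x)) => a h.
  move: (D _) => z; rewrite ler_norml => /andP[z1 z2].
  rewrite lerBlDr -lerBlDl.
  have -> : z * (a - h) ^+ 2 - z * a ^+ 2 = z * (h ^+ 2 - 2 * (a * h)) by ring.
  (* AM-GM: [2 a h <= t a^2 + h^2 / t] *)
  have amgm (c : R) : c ^+ 2 = 1 -> c * (2 * (a * h)) <= t * a ^+ 2 + t^-1 * h ^+ 2.
    move=> c1; have : 0 <= t^-1 * (t * a - c * h) ^+ 2.
      by rewrite mulr_ge0 ?sqr_ge0// invr_ge0 ltW.
    have -> : t^-1 * (t * a - c * h) ^+ 2 = t * a ^+ 2 - c * (2 * (a * h)) +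
        c ^+ 2 * (t^-1 * h ^+ 2) by field; rewrite gt_eqF.
    by rewrite c1; lra.
  have p1 := amgm 1 (expr1n _ _); have p2 := amgm (-1) (etrans (sqrrN 1) (expr1n _ _)).
  have h2 : 0 <= h ^+ 2 := sqr_ge0 h.
  have th2 : 0 <= t^-1 * h ^+ 2 by rewrite mulr_ge0// invr_ge0 ltW.
  have -> : (t^-1 + 1) * h ^+ 2 = t^-1 * h ^+ 2 + h ^+ 2 by ring.
  move: p1 p2 h2 th2; rewrite mul1r mulN1r.
  move: (2 * (a * h)) (t * a ^+ 2) (h ^+ 2) (t^-1 * h ^+ 2) => p u w v p1 p2 w0 v0.
  have q1 : w - p <= u + (v + w) by lra.
  have q2 : - (u + (v + w)) <= w - p by lra.
  by nra.
rewrite sumrB -mulr_sumr big_split/= -!mulr_sumr => h.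
by apply: le_trans h; rewrite mulNr lerDr.
Qed.

(** Splitting [L] into outer products reduces the trace to squares of scalar functions, whose high
    parts recombine into [tr (L h h^T) <= k tr (h h^T)]. *)
Lemma trace_test_ge (r : nat) (t k : R) (L : 'M[R]_r) (p : boolcube -> 'M[R]_r) :
  0 < t -> psd L -> psd (k%:M - L) ->
  - B * (t * \sum_x \tr (L *m (p x *m (p x)^T)) +
    (t^-1 + 1) * (k * \sum_i \sum_j \sum_x high_part s e (fun x => p x i j) x ^+ 2)) <=
  \sum_x D (restr s x) * \tr (L *m (p x *m (p x)^T)).
Proof.
move=> t0 pL pkL; have [u uE] := psd_sum_outer pL.
pose f a j x := \sum_i u a i 0 * p x i j.
have trE (q : 'M[R]_r) : \tr (L *m (q *m q^T)) = \sum_a \sum_j (\sum_i u a i 0 * q i j) ^+ 2.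
  rewrite uE mulmx_suml raddf_sum/=; apply: eq_bigr => a _.
  rewrite -mulmxA mxtrace_mulC [LHS]big_ord1.
  have -> : (u a)^T *m (q *m q^T) *m u a = ((u a)^T *m q) *m ((u a)^T *m q)^T.
    by rewrite trmx_mul trmxK !mulmxA.
  rewrite mxE; apply: eq_bigr => j _.
  rewrite [X in _ * X]mxE -expr2; congr (_ ^+ 2); rewrite mxE.
  by apply: eq_bigr => i _; rewrite mxE.
have sumE (w : boolcube -> R) : \sum_x w x * \tr (L *m (p x *m (p x)^T)) =
    \sum_a \sum_j \sum_x w x * f a j x ^+ 2.
  under eq_bigr do rewrite trE mulr_sumr.
  rewrite exchange_big/=; apply: eq_bigr => a _.
  under eq_bigr do rewrite mulr_sumr.
  by rewrite exchange_big/=; apply: eq_bigr => j _; apply: eq_bigr.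
have high : \sum_a \sum_j \sum_x high_part s e (f a j) x ^+ 2 <=
    k * \sum_i \sum_j \sum_x high_part s e (fun x => p x i j) x ^+ 2.
  pose h x : 'M[R]_r := \matrix_(i, j) high_part s e (fun x => p x i j) x.
  have -> : \sum_a \sum_j \sum_x high_part s e (f a j) x ^+ 2 =
      \sum_x \tr (L *m (h x *m (h x)^T)).
    under [RHS]eq_bigr do rewrite trE.
    rewrite [RHS]exchange_big/=; apply: eq_bigr => a _.
    rewrite [RHS]exchange_big/=; apply: eq_bigr => j _; apply: eq_bigr => x _.
    rewrite /f high_part_sum; congr (_ ^+ 2).
    by apply: eq_bigr => i _; rewrite mxE.
  have -> : \sum_i \sum_j \sum_x high_part s e (fun x => p x i j) x ^+ 2 =
      \sum_x \tr (h x *m (h x)^T).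
    rewrite [RHS]exchange_big/=; apply: eq_bigr => i _.
    under [RHS]eq_bigr do rewrite mxE.
    rewrite [RHS]exchange_big/=; apply: eq_bigr => j _; apply: eq_bigr => x _.
    by rewrite !mxE expr2.
  rewrite mulr_sumr; apply: ler_sum => x _.
  by apply: psd_tr_le => //; exact: psd_mul_tr.
have sum1E : \sum_x \tr (L *m (p x *m (p x)^T)) = \sum_a \sum_j \sum_x f a j x ^+ 2.
  under eq_bigr do rewrite trE.
  rewrite exchange_big/=; apply: eq_bigr => a _.
  by rewrite exchange_big/=; apply: eq_bigr => j _; apply: eq_bigr.
have lin (c : R) (S H : 'I_r -> 'I_r -> R) :
    \sum_a \sum_j - B * (t * S a j + c * H a j) =
    - B * (t * (\sum_a \sum_j S a j) + c * (\sum_a \sum_j H a j)).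
  rewrite !mulr_sumr -big_split/= mulr_sumr; apply: eq_bigr => a _.
  by rewrite !mulr_sumr -big_split/= mulr_sumr.
rewrite sum1E sumE.
apply: le_trans (ler_sum _ (fun a _ => ler_sum _ (fun j _ => sqr_test_ge (f a j) t0))).
rewrite lin !mulNr lerN2 ler_pM2l// lerD2l ler_wpM2l//.
by rewrite addr_ge0// invr_ge0 ltW.
Qed.

End PseudoPositivity.

(** * Moments of the averaged tests *)

Section Core.
Variables (R : realType) (m b n r e : nat).
Variable idx : 'I_m -> 'I_b -> 'I_n.
Hypothesis idx_inj : injective (fun p => idx p.1 p.2).
Hypotheses (b0 : (0 < b)%N) (r0 : (0 < r)%N).
Variables (D : cube m -> R) (B : R).
Hypothesis D_sqr_ge0 : forall g, lowdeg e g -> 0 <= \sum_y D y * g y ^+ 2.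
Hypotheses (B0 : 0 < B) (D_le : forall y, `|D y| <= B).
Local Notation sections := {ffun 'I_m -> 'I_b}.
Local Notation D_of s x := (D (restr (section_of idx s) x)).

Lemma card_sections : #|sections|%:R = b%:R ^+ m :> R.
Proof. by rewrite card_ffun !card_ord natrX. Qed.

Definition tester (L : sections -> 'M[R]_r) (x : cube n) : 'M[R]_r :=
  (b%:R ^+ m)^-1 *: \sum_s D_of s x *: L s.

Lemma tester_trace L (P : 'M[R]_r) x : \tr (tester L x *m P) =
  (b%:R ^+ m)^-1 * \sum_s D_of s x * \tr (L s *m P).
Proof.
rewrite -scalemxAl mxtraceZ mulmx_suml raddf_sum/=; congr (_ * _).
by apply: eq_bigr => s _; rewrite -scalemxAl mxtraceZ.
Qed.

(** [B + c Z] is [B] times the defect of the mean of the [L s] from 1, plus the mean of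
    [(B + c D) L s]. The condition [c^2 = 1] treats both signs at once. *)
Lemma tester_bound L (c : R) x : c ^+ 2 = 1 -> (forall s, psd (L s)) ->
  psd (1%:M - (b%:R ^+ m)^-1 *: \sum_s L s) -> psd (B%:M + c *: tester L x).
Proof.
move=> c1 pL pA.
have -> : B%:M + c *: tester L x = B *: (1%:M - (b%:R ^+ m)^-1 *: \sum_s L s) +
    (b%:R ^+ m)^-1 *: \sum_s (B + c * D_of s x) *: L s.
  have -> : \sum_s (B + c * D_of s x) *: L s =
      B *: (\sum_s L s) + c *: (\sum_s D_of s x *: L s).
    rewrite !scaler_sumr -big_split; apply: eq_bigr => s _ /=.
    by rewrite scalerDl scalerA.
  rewrite scalerBr scalerDr scale_scalar_mx mulr1 !scalerA (mulrC B).
  by rewrite addrA subrK (mulrC c).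
apply: psdD; first by apply: psdZ => //; exact: ltW.
apply: psdZ; first by rewrite invr_ge0 exprn_ge0.
apply: psd_sum => s _; apply: psdZ => //.
have : `|c * D_of s x| <= B.
  suff c_norm : `|c| = 1 by rewrite normrM c_norm mul1r.
  by apply/eqP; rewrite -(@eqrXn2 _ 2)// -normrX c1 normr1 expr1n.
by rewrite ler_norml; lra.
Qed.

Lemma tester_lowdeg L i j : lowdeg m (fun x => tester L x i j).
Proof.
pose f s (x : cube n) : R := (b%:R ^+ m)^-1 * L s i j * D_of s x.
apply: (@eq_lowdeg _ _ _ (fun x => \sum_s f s x)).
  apply: lowdeg_sum => s _; apply: lowdegZ.
  have := lowdeg_restr (section_of_inj (s := s) idx_inj) D.
  by rewrite card_ord.
move=> x; rewrite mxE summxE mulr_sumr; apply: eq_bigr => s _.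
by rewrite mxE /f; ring.
Qed.

Lemma lowdeg_exp (Y : cube n -> 'M[R]_r) (q : nat) i j :
  (forall i j, lowdeg m (fun x => Y x i j)) -> lowdeg (q * m) (fun x => (Y x ^+ q) i j).
Proof.
move=> lY; elim: q i j => [|q IH] i j.
  by apply: eq_lowdeg (lowdeg_cst ((1 : 'M[R]_r) i j)) _ => x; rewrite expr0.
apply: (@eq_lowdeg _ _ _ (fun x => \sum_k Y x i k * (Y x ^+ q) k j)).
  by apply: lowdeg_sum => k _; rewrite mulSn; apply: lowdegM.
by move=> x; rewrite exprS -mulmxE mxE.
Qed.

(** Averaged over sections, the term in [t] costs only the mean of the [L s], at most 1; the large
    bound [k] on single [L s] meets only the high parts, which are small on average. *)
Lemma tester_ge (t k : R) (l : nat) L (p : cube n -> 'M[R]_r) :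
  0 < t -> 0 <= k -> (l <= b)%N -> (forall s, psd (L s)) ->
  psd (1%:M - (b%:R ^+ m)^-1 *: \sum_s L s) -> (forall s, psd (k%:M - L s)) ->
  (forall i j, lowdeg l (fun x => p x i j)) ->
  - B * (t + (t^-1 + 1) * (k * (2 ^+ m * (l%:R / b%:R) ^+ e.+1))) *
    \sum_x \tr (p x *m (p x)^T) <=
  \sum_x \tr (tester L x *m (p x *m (p x)^T)).
Proof.
move=> t0 k0 lb pL pA pk lp.
have bm : 0 < b%:R ^+ m :> R by rewrite exprn_gt0// ltr0n.
under [leRHS]eq_bigr do rewrite tester_trace.
rewrite -mulr_sumr ler_pdivlMl// [leRHS]exchange_big/=.
have test s := trace_test_ge (section_of_inj (s := s) idx_inj)
  D_sqr_ge0 B0 D_le p t0 (pL s) (pk s).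
apply: le_trans (ler_sum _ (fun s _ => test s)).
set S := \sum_x \tr (p x *m _).
have SE : S = \sum_i \sum_j \sum_x p x i j ^+ 2.
  rewrite /S [LHS]exchange_big/=; apply: eq_bigr => i _.
  under eq_bigr do rewrite mxE.
  rewrite [LHS]exchange_big/=; apply: eq_bigr => j _; apply: eq_bigr => x _.
  by rewrite mxE expr2.
have h1 : \sum_s \sum_x \tr (L s *m (p x *m (p x)^T)) <= b%:R ^+ m * S.
  rewrite exchange_big/= mulr_sumr; apply: ler_sum => x _.
  rewrite -raddf_sum -mulmx_suml/= -ler_pdivrMl//.
  rewrite -mxtraceZ scalemxAl -[leRHS]mul1r.
  by apply: psd_tr_le => //; exact: psd_mul_tr.
have h2 : \sum_s \sum_i \sum_j \sum_x
    high_part (section_of idx s) e (fun x => p x i j) x ^+ 2 <=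
    b%:R ^+ m * 2 ^+ m * (l%:R / b%:R) ^+ e.+1 * S.
  rewrite exchange_big/= SE mulr_sumr; apply: ler_sum => i _.
  rewrite exchange_big/= mulr_sumr; apply: ler_sum => j _.
  exact: sum_high_part_random.
rewrite -mulr_sumr big_split/= -!mulr_sumr.
have c0 : 0 <= (t^-1 + 1) * k by rewrite mulr_ge0// addr_ge0// invr_ge0 ltW.
have := ler_wpM2l (ltW t0) h1; have := ler_wpM2l c0 h2.
move: (\sum_s \sum_x _) (\sum_s \sum_i _) => a c h3 h4.
move: (2 ^+ m) (_ ^+ e.+1) (b%:R ^+ m) (t^-1 + 1) h3 h4 => z q v g h3 h4.
have h5 : t * a + g * (k * c) <= v * ((t + g * (k * (z * q))) * S) by lra.
by have := ler_wpM2l (ltW B0) h5; lra.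
Qed.

Variables (L : sections -> 'M[R]_r) (Q : cube n -> 'M[R]_r) (d : R) (N : nat).
Hypotheses (pL : forall s, psd (L s)) (pQ : forall x, psd (Q x)).
Hypothesis LQ_le : forall s x, \tr (L s *m Q x) <= 2.
Hypothesis d0 : 0 < d.
Hypothesis LQ_test : forall s, \sum_x D_of s x * \tr (L s *m Q x) <= - d * 2 ^+ n.
Hypothesis Nb : (N * m <= b)%N.
Hypothesis test_small : B * (d / (20 * B) + ((d / (20 * B))^-1 + 1) *
  (2 * r%:R ^+ 2 * (2 ^+ m * ((N * m)%:R / b%:R) ^+ e.+1))) < d / 10.

(* Let [a q] and [w q] be the moments of [Y = B - Z], where [Z] averages the tests,
   without weight and with weight [Q]. They are log-convex. The tests of [Q] make [w q],
   hence [a q], grow at rate [B + d / 5], whereas positivity of [D] on squares keeps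
   the ratio [a (2 N + 1) / a (2 N)] below [B + d / 10]. *)
Lemma core_bound : (B + d / 5) ^+ (2 * N).+1 * d <= 5 * B * r%:R * (B + d / 10) ^+ (2 * N).+1.
Proof.
pose s0 : sections := [ffun=> Ordinal b0].
have [G [H [GH pA pk trQ]]] := psd_family_rescale s0 r0 pL pQ LQ_le.
have HG := mulmx1C GH.
pose L' s := G *m L s *m G^T; pose Q' x := H^T *m Q x *m H.
have pL' s : psd (L' s) by exact: psd_conj.
have pQ' x : psd (Q' x) by have := psd_conj H^T (pQ x); rewrite trmxK.
have LQE s x : \tr (L' s *m Q' x) = \tr (L s *m Q x).
  rewrite /L' /Q' !mulmxA mxtrace_mulC !mulmxA HG mul1mx.
  by rewrite -(mulmxA (L s)) -trmx_mul HG trmx1 mulmx1.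
rewrite card_sections -/L' in pA.
pose Z x := tester L' x; pose Y x := B%:M - Z x.
have pBZ (c : R) x : c ^+ 2 = 1 -> psd (B%:M + c *: Z x).
  by move=> c1; exact: tester_bound.
have pY x : psd (Y x).
  have := @pBZ (-1) x; rewrite scaleN1r; apply.
  by rewrite sqrrN expr1n.
pose a q := \sum_x \tr (1%:M *m Y x ^+ q); pose w q := \sum_x \tr (Q' x *m Y x ^+ q).
have a_ge0 q : 0 <= a q.
  by apply: sumr_ge0 => x _; apply: psd_trM_ge0; [exact: psd1|exact: psd_exp].
have w_ge0 q : 0 <= w q.
  by apply: sumr_ge0 => x _; apply: psd_trM_ge0 => //; exact: psd_exp.
have a_lc q : a q.+1 ^+ 2 <= a q * a q.+2.
  by apply: trace_moment_logconvex => // x; exact: psd1.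
have w_lc q : w q.+1 ^+ 2 <= w q * w q.+2 by exact: trace_moment_logconvex.
have a0E : a 0 = r%:R * 2 ^+ n.
  rewrite /a; under eq_bigr do rewrite expr0 mul1mx mxtrace1.
  by rewrite sumr_const card_ffun card_bool card_ord -[LHS]mulr_natr natrX.
have w0E : w 0 = \sum_x \tr (Q' x).
  by apply: eq_bigr => x _; rewrite expr0 mulmx1.
have wZ : \sum_x \tr (Q' x *m Z x) <= - d * 2 ^+ n.
  under eq_bigr do rewrite mxtrace_mulC tester_trace.
  have bm : 0 < b%:R ^+ m :> R by rewrite exprn_gt0// ltr0n.
  rewrite -mulr_sumr exchange_big/= ler_pdivrMl//.
  apply: le_trans (_ : \sum_(s : sections) - d * 2 ^+ n <= _).
    by apply: ler_sum => s _; under eq_bigr do rewrite LQE.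
  by rewrite sumr_const -[leLHS]mulr_natl card_sections.
have w_le q : w q <= 5 * a q.
  rewrite mulr_sumr; apply: ler_sum => x _; rewrite mul1mx.
  have pe := psd_exp q (pY x).
  apply: le_trans (psd_tr_le (psd_le_tr (pQ' x)) pe) _.
  by apply: ler_wpM2r; [exact: psd_tr_ge0|exact: trQ].
have w1E : w 1 = B * w 0 - \sum_x \tr (Q' x *m Z x).
  rewrite w0E mulr_sumr -sumrB; apply: eq_bigr => x _.
  by rewrite expr1 mulmxBr linearB/= mul_mx_scalar mxtraceZ.
have p2 : 0 < 2 ^+ n :> R by rewrite exprn_gt0.
(* Positivity of [B + Z] turns the negative test into a lower bound on the mass of [Q']. *)
have w0_ge : d * 2 ^+ n <= B * w 0.
  have : 0 <= B * w 0 + \sum_x \tr (Q' x *m Z x).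
    rewrite w0E mulr_sumr -big_split/= sumr_ge0// => x _.
    rewrite -mxtraceZ -mul_mx_scalar -mxtraceD -mulmxDr.
    apply: psd_trM_ge0 => //; have := @pBZ 1 x; rewrite scale1r; apply.
    by rewrite expr1n.
  by lra.
have w0_gt : 0 < w 0.
  by rewrite -(pmulr_rgt0 _ B0); apply: lt_le_trans w0_ge; rewrite mulr_gt0.
have w0_le : w 0 <= 5 * 2 ^+ n.
  rewrite w0E; apply: le_trans (ler_sum _ (fun x _ => trQ x)) _.
  by rewrite sumr_const card_ffun card_bool card_ord -[leLHS]mulr_natr natrX.
(* The gain [d 2^n] is at least [(d / 5) w 0], since [w 0 <= 5 * 2^n]. *)
have w1_ge : (B + d / 5) * w 0 <= w 1.
  rewrite w1E mulrDl lerD2l lerNr; apply: le_trans wZ _.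
  by rewrite mulNr lerN2 -mulrA ler_pM2l// mulrC ler_pdivrMr// mulrC.
have lower := logconvex_lower w_lc (addr_gt0 B0 (divr_gt0 d0 (ltr0Sn _ 4))) w0_gt w1_ge (2 * N).+1.
have ratio : a (2 * N).+1 <= (B + d / 10) * a (2 * N)%N.
  rewrite leNgt; apply/negP => big.
  have sY x : (Y x ^+ N)^T = Y x ^+ N by apply: trmx_exp; exact: psd_trmx.
  have YY x : Y x ^+ N *m (Y x ^+ N)^T = Y x ^+ (2 * N).
    by rewrite sY mulmxE -exprD addnn mul2n.
  have lY i j : lowdeg m (fun x => Y x i j).
    apply: (@eq_lowdeg _ _ _ (fun x => B *+ (i == j) + -1 * Z x i j)).
      by apply: lowdegD (lowdeg_cst _) (lowdegZ _ _); exact: tester_lowdeg.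
    by move=> x; rewrite !mxE mulN1r.
  (* With this [t], [B t = d / 20] is half of the allowance [d / 10]; [test_small] leaves the other
     half to the high parts. *)
  have t0 : 0 < d / (20 * B) by rewrite divr_gt0// mulr_gt0.
  have k0 : 0 <= 2 * r%:R ^+ 2 :> R by rewrite mulr_ge0// sqr_ge0.
  have := tester_ge t0 k0 Nb pL' pA pk (fun i j => @lowdeg_exp Y N i j lY).
  have -> : \sum_x \tr (Y x ^+ N *m (Y x ^+ N)^T) = a (2 * N)%N.
    by apply: eq_bigr => x _; rewrite YY mul1mx.
  have -> : \sum_x \tr (tester L' x *m (Y x ^+ N *m (Y x ^+ N)^T)) =
      B * a (2 * N)%N - a (2 * N).+1.
    rewrite mulr_sumr -sumrB; apply: eq_bigr => x _.
    rewrite YY.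
    rewrite -/(Z x) !mul1mx exprS -mulmxE mulmxBl linearB/= mul_scalar_mx mxtraceZ.
    by rewrite opprB addrC subrK.
  have h := ler_wpM2r (a_ge0 (2 * N)%N) (ltW test_small).
  rewrite -mulrA mulNr mulrA => h2.
  by move: h h2 big; rewrite mulrDl; lra.
have upper := logconvex_upper a_ge0 a_lc _ ratio.
rewrite a0E in upper.
have c0 : 0 <= B + d / 10 by rewrite addr_ge0 ?divr_ge0 ?ltW.
have {}upper := upper c0.
have := le_trans lower (le_trans (w_le _) (ler_wpM2l _ upper)).
move=> /(_ (ler0n _ _)).
move: (B + d / 5) (addr_ge0 (ltW B0) (ltW (divr_gt0 d0 (ltr0Sn _ 4)))) => c cp.
have := exprn_ge0 (2 * N).+1 cp; move: (c ^+ _) => x; move: (_ ^+ (2 * N).+1) => y x0 h.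
rewrite -(ler_pM2r p2).
have := ler_wpM2l x0 w0_ge; have := ler_wpM2l (ltW B0) h.
by move: (w 0) (2 ^+ n) (r%:R) => u v z; lra.
Qed.

End Core.

(** * Planting a bad instance on a section *)

Section Planting.
Variables (R : realType) (k : nat) (Pi : {set predicate k}) (m : nat).
Variable I : instance Pi m.

Definition plant_constraint n (s : 'I_m -> 'I_n) (C : constraint k m) : constraint k n :=
  (C.1, [ffun j => s (C.2 j)]).

Lemma plantable n (s : 'I_m -> 'I_n) : injective s -> exists J : instance Pi n,
  forall x : cube n, value R J x = value R I (restr s x).
Proof.
move=> s_inj; have ne := constraints_neq0 I; have /allP inP := constraints_in I.
have ne' : map (plant_constraint s) (constraints I) != [::] by case: (constraints I) ne.
have in' : all (fun C : constraint k n => (C.1 \in Pi) && injectiveb C.2)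
    (map (plant_constraint s) (constraints I)).
  apply/allP => _ /mapP[C /inP/andP[CPi /injectiveP C_inj] ->] /=.
  rewrite CPi; apply/injectiveP => i j; rewrite !ffunE.
  by move=> /s_inj/C_inj.
exists (Instance ne' in') => x; rewrite /value /= size_map big_map.
congr (_ * _); apply: eq_bigr => C _; congr ((_ : bool)%:R).
by rewrite /satisfied; congr (C.1 _); apply/ffunP => j; rewrite !ffunE.
Qed.

Lemma value_ge0 n (J : instance Pi n) (x : cube n) : 0 <= value R J x.
Proof. by rewrite mulr_ge0 ?invr_ge0// sumr_ge0. Qed.

Lemma value_le_opt n (J : instance Pi n) (x : cube n) : value R J x <= opt R J.
Proof. by rewrite /opt (bigD1 x)//= le_max lexx. Qed.

Lemma opt_le n (J : instance Pi n) (a : R) :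
  0 <= a -> (forall x, value R J x <= a) -> opt R J <= a.
Proof.
by move=> a0 h; rewrite /opt; elim/big_ind: _ => // x y xa ya; rewrite ge_max xa.
Qed.

End Planting.

Section SizeBound.
Variables (R : realType) (k : nat) (Pi : {set predicate k}) (c s : R).
Hypotheses (s_ge0 : 0 <= s) (c_le1 : c <= 1).
Variables (r : nat -> nat) (S : forall n : nat, sdp_relaxation R Pi n (r n)).
Hypothesis ach : sdp_achieves S c s.
Variables (m e : nat) (I : instance Pi m) (D : cube m -> R) (B : R).
Hypothesis I_le : opt R I <= s.
Hypothesis D_sqr_ge0 : forall g, lowdeg e g -> 0 <= \sum_y D y * g y ^+ 2.
Hypotheses (B0 : 0 < B) (D_le : forall y, `|D y| <= B).
(** Half of the mean gap; the other half pays for the error of the approximate duality. *)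
Let d := - (\sum_y D y * (c - value R I y)) / (2 * 2 ^+ m).
Hypothesis d0 : 0 < d.

Lemma planted_tests n (t : 'I_m -> 'I_n) : injective t ->
  exists L : 'M[R]_(r n),
  [/\ psd L, forall x, \tr (L *m sdp_point (S n) x) <= 2 &
      \sum_x D (restr t x) * \tr (L *m sdp_point (S n) x) <= - d * 2 ^+ n].
Proof.
move=> t_inj; have [J JE] := plantable R I t_inj.
have Jle : opt R J <= s.
  apply: opt_le => // x; rewrite JE; apply: le_trans I_le; exact: value_le_opt.
(* [z <= 1] keeps the traces at most 2, and [B z <= d] limits the error weighted by [D]. *)
pose z := d / (B + d).
have Bd : 0 < B + d by rewrite addr_gt0.
have z0 : 0 < z by rewrite divr_gt0.
have z1 : z <= 1 by rewrite ler_pdivrMr// mul1r lerDr ltW.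
have Bz : B * z <= d.
  by rewrite mulrA ler_pdivrMr// mulrC ler_pM2l// lerDl ltW.
have [L [a [pL a0 La]]] := sdp_duality z0 (@ach n J Jle).
exists L; split=> // [x|].
  have := La x; rewrite ler_norml => /andP[+ _].
  by have := value_ge0 R J x; move: z1 c_le1; lra.
pose F y := D y * (c - value R I y).
have sD : 0 <= \sum_y D y.
  have := D_sqr_ge0 (@lowdeg_cst _ _ e 1).
  by under eq_bigr do rewrite expr1n mulr1.
have sF : \sum_x F (restr t x) = - 2 * d * 2 ^+ n.
  have := sum_restr t_inj F; rewrite !card_ord => h.
  have m0 : 2 ^+ m != 0 :> R by exact: two_neq0.
  apply: (mulfI m0); rewrite h -/d /d -/(F _).
  by rewrite /F; field.
have sD' : 0 <= \sum_x D (restr t x).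
  have := sum_restr t_inj D; rewrite !card_ord => h.
  by rewrite -(pmulr_rge0 _ (exprn_gt0 m (ltr0n R 2))) h mulr_ge0// exprn_ge0.
apply: (@le_trans _ _ (\sum_x (F (restr t x) - a * D (restr t x) + d))).
  apply: ler_sum => x _; rewrite /F -JE.
  have := La x; have := D_le (restr t x); move: (\tr _) (D _) (value _ _ _) => u v w.
  move=> v1 h; have : `|v * (c - w - (u + a))| <= d.
    by rewrite normrM; apply: le_trans Bz; exact: ler_pM.
  by rewrite ler_norml => /andP[+ _]; lra.
rewrite big_split/= sumrB -mulr_sumr sF sumr_const card_ffun card_bool card_ord.
rewrite -[d *+ _]mulr_natr natrX.
have := mulr_ge0 a0 sD'; lra.
Qed.

Lemma sdp_size_bound (b N : nat) (n := (m.+1 * b)%N) : (0 < b)%N -> (N * m <= b)%N ->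
  B * (d / (20 * B) + ((d / (20 * B))^-1 + 1) *
  (2 * (r n)%:R ^+ 2 * (2 ^+ m * ((N * m)%:R / b%:R) ^+ e.+1))) < d / 10 ->
  (B + d / 5) ^+ (2 * N).+1 * d <= 5 * B * (r n)%:R * (B + d / 10) ^+ (2 * N).+1.
Proof.
move=> b0 Nb small.
(* The variables form an array whose first [m] rows are the blocks; the extra row makes [n] grow
   with [b] even if [m = 0]. *)
pose idx (j : 'I_m) (a : 'I_b) : 'I_n := mxvec_index (widen_ord (leqnSn m) j) a.
have idx_inj : injective (fun p => idx p.1 p.2).
  have [g gK _] := curry_mxvec_bij m.+1 b.
  move=> [j a] [j' a'] /= jj.
  have := congr1 g jj; rewrite (gK (_, _) isT) (gK (_, _) isT) => -[jE ->].
  by congr (_, _); apply/val_inj.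
have /fin_all_exists[L LP] (t : {ffun 'I_m -> 'I_b}) :=
  planted_tests (section_of_inj (s := t) idx_inj).
have pQ x : psd (sdp_point (S n) x) by have [_] := sdp_point_feasible (S n) x.
apply: (core_bound idx_inj b0 _ D_sqr_ge0 B0 D_le (fun t => let: And3 h _ _ := LP t in h)
  pQ (fun t => let: And3 _ h _ := LP t in h) d0 (fun t => let: And3 _ _ h := LP t in h)
  Nb small).
(* In size 0 all traces vanish, contrary to the strictly negative test. *)
rewrite lt0n; apply/negP => /eqP r0.
have [_ _] := LP [ffun=> Ordinal b0].
rewrite big1 => [|x _].
  by rewrite mulNr oppr_ge0 leNgt mulr_gt0// exprn_gt0.
suff -> : \tr (L [ffun=> Ordinal b0] *m sdp_point (S n) x) = 0 by rewrite mulr0.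
by apply: big1 => i; exfalso; case: i; rewrite -/n r0.
Qed.

End SizeBound.

(** * Asymptotics *)

Section Asymptotics.
Local Open Scope classical_set_scope.
Local Open Scope ring_scope.
Variable R : realType.

(** [ln x = 2 ln (sqrt x) <= 2 sqrt x], while [sqrt x >= 2 a]. *)
Lemma ln_div_small (a x : R) : 1 <= a -> 4 * a ^+ 2 <= x -> a * (ln x / x) <= 1.
Proof.
move=> a1 ax.
have a0 : 0 < a by exact: lt_le_trans a1.
have x0 : 0 < x by apply: lt_le_trans ax; rewrite mulr_gt0// exprn_gt0.
pose y := Num.sqrt x.
have y0 : 0 < y by rewrite sqrtr_gt0.
have xE : x = y ^+ 2 by rewrite sqr_sqrtr// ltW.
have lnx : ln x <= 2 * y.
  by rewrite xE lnXn// mulr2n; have := ln_sublinear y0; lra.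
have ya : 2 * a <= y.
  rewrite -(@ler_pXn2r _ 2)// ?nnegrE ?mulr_ge0 ?(ltW a0) ?(ltW y0)// -xE exprMn.
  by apply: le_trans ax; rewrite le_eqVlt; apply/orP; left; apply/eqP; ring.
rewrite mulrA ler_pdivrMr// mul1r.
apply: le_trans (ler_wpM2l (ltW a0) lnx) _.
by rewrite xE expr2 mulrA (mulrC a) ler_pM2r.
Qed.

(** Fourth powers turn the real exponent [d / 4] into the natural number [d]. *)
Lemma littleo_powR_bound (d : nat) (f : nat -> R) (u : R) :
  (f : nat -> R^o) =o_\oo (fun n : nat => (n%:R / ln n%:R) `^ (d%:R / 4) : R^o) ->
  0 < u -> exists N0 : nat, forall n : nat, (N0 <= n)%N -> 1 < n%:R :> R ->
    f n ^+ 4 <= u ^+ 4 * (n%:R / ln n%:R) ^+ d.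
Proof.
move=> /eqoP fo u0; have [N0 _ NP] := fo u u0.
exists N0 => n nN n1; have := NP n nN; rewrite /= => h.
have q0 : 0 <= n%:R / ln n%:R :> R by rewrite divr_ge0// ln_ge0// ltW.
have -> : (n%:R / ln n%:R) ^+ d = ((n%:R / ln n%:R) `^ (d%:R / 4)) ^+ 4 :> R.
  by rewrite -powR_mulrn ?powR_ge0// -powRrM divfK ?pnatr_eq0// powR_mulrn.
rewrite -exprMn; have -> : f n ^+ 4 = `|f n| ^+ 4.
  by rewrite -normrX ger0_norm// (exprM _ 2 2) sqr_ge0.
rewrite lerXn2r ?nnegrE// ?mulr_ge0 ?powR_ge0 ?(ltW u0)//.
by move: h; rewrite (ger0_norm (powR_ge0 _ _)).
Qed.

(** [N] is about [A ln n], with [A] such that [(1 + g)^N >= n^(d + 1)], which exceeds [C r]. Then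
    [N m / b] is of order [ln n / n], whose power [e + 1] outweighs [r^2] since [d <= 2 (e + 1)]. *)
Lemma size_asymptotics (d e m : nat) (r : nat -> nat) (g C h : R) :
  (d <= e.+1 * 2)%N ->
  (fun n : nat => (r n)%:R : R^o) =o_\oo
    (fun n : nat => (n%:R / ln n%:R) `^ (d%:R / 4) : R^o) ->
  0 < g -> 0 < C -> 0 < h ->
  exists b N, [/\ (0 < b)%N, (N * m <= b)%N,
    (r (m.+1 * b)%N)%:R ^+ 2 * ((N * m)%:R / b%:R) ^+ e.+1 < h &
    C * (r (m.+1 * b)%N)%:R < (1 + g) ^+ (2 * N).+1].
Proof.
move=> de fo g0 C0 h0.
have lg : 0 < ln (1 + g) by rewrite ln_gt0// ltrDl.
pose A := d.+1%:R / ln (1 + g).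
have A0 : 0 < A by rewrite divr_gt0.
pose M := m.+1%:R : R.
have M1 : 1 <= M by rewrite ler1n.
have M0 : 0 < M by rewrite ltr0n.
(* One factor [M] bounds [m], the other converts [1 / b] into [M / n]. *)
pose a := (A + 1) * M ^+ 2.
have a1 : 1 <= a.
  rewrite -[leLHS]mul1r ler_pM// ?expr_ge1//; first by rewrite lerDr ltW.
pose K := (e.+1 * 2)%N.
have aK : 0 < a ^+ K by rewrite exprn_gt0// (lt_le_trans ltr01).
(* Chosen for [u <= 1] and [u a^K < h^2]. *)
pose u := h ^+ 2 / (a ^+ K + h ^+ 2).
have h2 : 0 < h ^+ 2 by rewrite exprn_gt0.
have u0 : 0 < u by rewrite divr_gt0// addr_gt0.
have u1 : u <= 1 by rewrite ler_pdivrMr ?addr_gt0// mul1r lerDr ltW.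
have uh : u * a ^+ K < h ^+ 2.
  rewrite mulrAC ltr_pdivrMr ?addr_gt0// ltr_pM2l// ltrDl//.
have u4 : u ^+ 4 <= u by rewrite exprS ler_piMr ?exprn_ile1 ?(ltW u0).
have [N0 NP] := littleo_powR_bound fo u0.
clearbody u.
(* Beyond [X] the little-o bound holds, [ln n >= 1], [a ln n / n <= 1] and [n > C]. *)
pose X := N0%:R + expR 1 + 4 * a ^+ 2 + C + 1.
have ge4 : 0 <= 4 * a ^+ 2 by rewrite mulr_ge0// sqr_ge0.
have e1 := expR_gt0 (1 : R).
have N00 : 0 <= N0%:R :> R by [].
have X0 : 0 <= X by rewrite /X; lra.
pose b := (Num.truncn X).+1.
pose n := (m.+1 * b)%N.
have bX : X < b%:R by have /andP[] := truncn_itv X0.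
have nE : n%:R = M * b%:R :> R by rewrite natrM.
have bR : 0 < b%:R :> R by rewrite ltr0n.
have nX : X < n%:R by apply: lt_le_trans bX _; rewrite nE ler_peMl// ltW.
have nN : (N0 <= n)%N by rewrite -(ler_nat R); move: nX; rewrite /X; lra.
have n1 : 1 < n%:R :> R by move: nX; rewrite /X; lra.
have n0 : 0 < n%:R :> R by lra.
have ne : expR 1 <= n%:R :> R.
  apply: le_trans (ltW nX); rewrite /X; move: e1 N00 ge4 C0; move: (expR 1) => y; lra.
have n4 : 4 * a ^+ 2 <= n%:R by move: nX; rewrite /X; lra.
have nC : C < n%:R by move: nX; rewrite /X; lra.
have ln1 : 1 <= ln n%:R :> R by rewrite -[leLHS]expRK ler_ln// posrE.
have aq := ln_div_small a1 n4.
pose q := ln n%:R / n%:R : R.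
have q0 : 0 < q by rewrite divr_gt0//; lra.
have q1 : q <= 1.
  by apply: le_trans aq; rewrite ler_peMl// ltW.
have qV : n%:R / ln n%:R = q^-1 :> R by rewrite /q invf_div.
have r4 := NP n nN n1; rewrite qV in r4.
pose N := (Num.truncn (A * ln n%:R)).+1.
have Al0 : 0 <= A * ln n%:R by rewrite mulr_ge0 ?ltW//; lra.
have /andP[Nle Nge] := truncn_itv Al0.
have Nle2 : N%:R <= (A + 1) * ln n%:R by rewrite -natr1 mulrDl mul1r lerD.
have wq : (N * m)%:R / b%:R <= a * q.
  have -> : a * q = (A + 1) * ln n%:R * M / b%:R.
    by rewrite /a /q nE; field; rewrite !gt_eqF.
  rewrite ler_pM2r ?invr_gt0// natrM ler_pM//.
  by rewrite ler_nat.
have w0 : 0 <= (N * m)%:R / b%:R :> R by rewrite divr_ge0.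
have w1 : (N * m)%:R / b%:R <= 1 :> R by exact: le_trans wq aq.
exists b, N; split=> //.
- by rewrite -(ler_nat R); move: w1; rewrite ler_pdivrMr// mul1r.
(* Squaring makes [r^4 <= u^4 (n / ln n)^d] applicable. *)
- rewrite -/n -(@ltr_pXn2r _ 2)// ?nnegrE ?(ltW h0) ?mulr_ge0 ?exprn_ge0//.
  rewrite exprMn -!exprM; apply: le_lt_trans uh.
  apply: (@le_trans _ _ (u ^+ 4 * q^-1 ^+ d * (a * q) ^+ K)).
    apply: ler_pM => //; rewrite ?exprn_ge0//.
    by rewrite lerXn2r// nnegrE mulr_ge0 ?(ltW q0)// (le_trans ler01).
  rewrite (exprMn _ a q).
  have -> : u ^+ 4 * q^-1 ^+ d * (a ^+ K * q ^+ K) = u ^+ 4 * a ^+ K * q ^+ (K - d).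
    have -> : q ^+ K = q ^+ (K - d) * q ^+ d by rewrite -exprD subnK.
    by rewrite exprVn; field; rewrite expf_neq0// gt_eqF.
  rewrite -[leRHS]mulr1; apply: ler_pM.
  + by rewrite mulr_ge0 ?(ltW aK) ?exprn_ge0 ?(ltW u0).
  + by rewrite exprn_ge0 ?(ltW q0).
  + by rewrite ler_pM2r.
  + by rewrite exprn_ile1 ?(ltW q0).
- rewrite -/n.
  have rn : (r n)%:R <= n%:R ^+ d :> R.
    apply: (@le_trans _ _ ((r n)%:R ^+ 4)).
      by case: (r n) => [|p]; rewrite ?expr0n// ler_eXnr// ler1n.
    apply: le_trans r4 _; rewrite -[leRHS]mul1r ler_pM ?exprn_ge0 ?invr_ge0 ?(ltW q0) ?(ltW u0)//.
      exact: le_trans u4 u1.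
    rewrite lerXn2r ?nnegrE ?invr_ge0 ?(ltW q0)// -qV ler_pdivrMr; last by lra.
    by rewrite ler_peMr.
  apply: (@lt_le_trans _ _ (n%:R ^+ d.+1)).
    apply: le_lt_trans (ler_wpM2l (ltW C0) rn) _.
    by rewrite exprS ltr_pM2r// exprn_gt0.
  apply: (@le_trans _ _ ((1 + g) ^+ N)); last first.
    apply: ler_weXn2l; first by rewrite lerDl ltW.
    by rewrite mul2n -addnn -addnS leq_addr.
  rewrite -ler_ln ?posrE ?exprn_gt0 ?addr_gt0// !lnXn ?addr_gt0//.
  rewrite -[leLHS]mulr_natl -[leRHS]mulr_natl -ler_pdivrMr//.
  by rewrite mulrAC ltW.
Qed.

End Asymptotics.

(** * Choice of constants and contradiction *)

Local Open Scope classical_set_scope.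
Local Open Scope ring_scope.

Theorem theorem6p2 (R : realType) (d k : nat) (Pi : {set predicate k})
    (hd : (2 * uphalf k <= d)%N)
    (c s : R) (hs : 0 <= s) (hsc : s <= c) (hc : c <= 1)
    (hsos : ~ sos_achieves Pi d c s)
    (r : nat -> nat) (S : forall n : nat, sdp_relaxation R Pi n (r n))
    (hr : (fun n : nat => (r n)%:R : R^o) =o_\oo
          (fun n : nat => (n%:R / ln n%:R) `^ (d%:R / 4) : R^o)) :
  ~ sdp_achieves S c s.
Proof.
move=> ach; apply: hsos => m I Is; apply: contrapT => nsos.
have [D [D_ge0 Dneg]] := pseudodensity hd nsos.
pose B : R := 1 + \sum_y `|D y|.
have S0 : 0 <= \sum_y `|D y| by apply: sumr_ge0.
have B0 : 0 < B by rewrite ltr_wpDr.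
have DB y : `|D y| <= B.
  rewrite /B (bigD1 y)//= addrCA lerDl addr_ge0//.
  by apply: sumr_ge0.
pose z := - (\sum_y D y * (c - value R I y)) / (2 * 2 ^+ m).
have z0 : 0 < z by rewrite divr_gt0 ?oppr_gt0// mulr_gt0// exprn_gt0.
have bound := sdp_size_bound hs hc ach Is D_ge0 B0 DB z0.
pose x := B + z / 5; pose y := B + z / 10.
have y0 : 0 < y by rewrite addr_gt0// divr_gt0.
(* [1 + g] is the ratio of the growth rate forced by the tests to the one allowed by positivity. *)
pose g := x / y - 1.
have g0 : 0 < g by rewrite subr_gt0 ltr_pdivlMr// mul1r /x /y; lra.
have gE : 1 + g = x / y by rewrite addrC subrK.
pose t := z / (20 * B).
have t0 : 0 < t by rewrite divr_gt0// mulr_gt0.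
pose v := B * (t^-1 + 1) * (2 * 2 ^+ m).
have v0 : 0 < v.
  by rewrite !mulr_gt0 ?exprn_gt0// addr_gt0// invr_gt0.
(* [5 B / z] is the factor of [r] in [bound] solved for [(x / y)^(2 N + 1)], and [z / 20 / v] keeps
   the high-degree term below [z / 20]. *)
have [||||b [N [b0 Nb small big]]] :=
  @size_asymptotics R d d./2 m r g (5 * B / z) (z / 20 / v) _ hr.
- rewrite muln2 doubleS -[X in (X <= _)%N](odd_double_half d).
  by case: (odd d); rewrite ?add1n ?add0n ltnW.
- exact: g0.
- by rewrite divr_gt0// mulr_gt0.
- by rewrite divr_gt0// divr_gt0.
have := bound b N b0 Nb; rewrite -/z -/t -/x -/y => /(_ _)/wrap[].
  have Bt : B * t = z / 20 by rewrite /t; field; rewrite gt_eqF.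
  move: small; rewrite ltr_pdivlMr//; move: (_ ^+ d./2.+1) (_ ^+ 2) => p w.
  rewrite /v [B * (t + _)]mulrDr Bt => small.
  have -> : z / 10 = z / 20 + z / 20 by field.
  by rewrite ltrD2l; apply: le_lt_trans small; rewrite le_eqVlt; apply/orP; left; apply/eqP; ring.
move=> h; move: big; rewrite gE expr_div_n ltr_pdivlMr ?exprn_gt0//.
rewrite ltNge => /negP; apply.
have -> : 5 * B / z * (r (m.+1 * b)%N)%:R * y ^+ (2 * N).+1 =
    (5 * B * (r (m.+1 * b)%N)%:R * y ^+ (2 * N).+1) / z.
  by field; rewrite gt_eqF.
by rewrite ler_pdivlMr.
Qed.
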